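(* If the graph $G$ is a tree on $n$ vertices, then the MBRTP problem (given $G$, a root $r$, capacities $c_v\in\mathbb{Z}_{\ge 0}$ for all vertices $v$, and a positive integer $K$, find a bounded rooted-tree packing $(T_1,\dots,T_K)$, $T_k=(V_k,E_k)$, maximizing $\sum_{k=1}^K |V_k|$) can be solved in polynomial time $\mathcal O(n^3K^3)$.
   Context: A rooted tree (or $r$-tree) of $G$ is an acyclic connected subgraph $T=(V_T,E_T)$ of $G$ with $r\in V_T$; the single vertex $(\{r\},\emptyset)$ is the null $r$-tree. The tree is viewed as rooted at $r$, and $C_T(v)$ denotes the number of children of $v$ in $T$ (taken to be $0$ if $v\notin V_T$). A family $(T_1,\dots,T_K)$ of $r$-trees of $G$ is a bounded rooted-tree packing if $\sum_{k=1}^K C_{T_k}(v)\le c_v$ for all vertices $v$. *)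

(* Defs.v *)
From mathcomp Require Import all_boot.

Set Implicit Arguments.
Unset Strict Implicit.
Unset Printing Implicit Defensive.

(* Finite simple graphs whose vertex set is a subset of V, so that the subgraphs
   of a graph on V are again objects of the same type. *)
Record sgraph (V : finType) := SGraph {
  verts : {set V};
  edge : rel V;
  edge_sym : symmetric edge;
  edge_irr : irreflexive edge;
  edge_verts : forall u v, edge u v -> u \in verts
}.

Section Graphs.
Variable V : finType.
Implicit Types G T : sgraph V.

Definition subgraph T G : Prop :=
  verts T \subset verts G /\ (forall u v, edge T u v -> edge G u v).

Definition connected G : Prop :=
  verts G != set0 /\ {in verts G &, forall u v, connect (edge G) u v}.

(* [ucycle] also accepts the degenerate closed walks of length at most 2. *)
Definition acyclic G : Prop :=
  forall s : seq V, ucycle (edge G) s -> size s <= 2.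

Definition is_tree G : Prop := connected G /\ acyclic G.

Definition rooted_tree G (r : V) T : Prop :=
  [/\ subgraph T G, is_tree T & r \in verts T].

(* u is a child of v in T rooted at r: v is the last vertex before u on a simple
   path r, ..., v, u of T.  The bound #|V| on the length of p is not a
   restriction, since the vertices of the path are distinct; it only makes the
   quantifier range over a finite type. *)
Definition is_child (r : V) T (v u : V) : bool :=
  [exists p : #|V|.-bseq V,
    [&& path (edge T) r (rcons p u), uniq (r :: rcons p u) & last r p == v]].

Definition children (r : V) T (v : V) : nat := #|[set u | is_child r T v u]|.

Definition packing G (r : V) (c : V -> nat) K (T : 'I_K -> sgraph V) : Prop :=
  (forall k, rooted_tree G r (T k)) /\
  (forall v, \sum_(k < K) children r (T k) v <= c v).

Definition packing_size K (T : 'I_K -> sgraph V) : nat :=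
  \sum_(k < K) #|verts (T k)|.

Definition max_packing G (r : V) (c : V -> nat) K (T : 'I_K -> sgraph V) : Prop :=
  packing G r c T /\
  (forall T' : 'I_K -> sgraph V,
     packing G r c T' -> packing_size T' <= packing_size T).

End Graphs.

(* A random access machine with unit cost.  Programs are structured, and use
   scalar registers and unbounded arrays of natural numbers.  Register and array
   names are literals, so a program uses only finitely many of each; array
   indices are computed, which gives indirect addressing.  Multiplication is
   deliberately not an operation: with addition and truncated subtraction only,
   one step lengthens the numbers in use by at most a constant number of bits,
   and the unit-cost measure is polynomially related to Turing machine time. *)
Inductive expr :=
  | Lit of nat
  | Reg of nat
  | Get of nat & expr
  | Add of expr & expr
  | Sub of expr & expr.

Inductive cmd :=
  | Skip
  | Assign of nat & expr
  | Put of nat & expr & expr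
  | Seq of cmd & cmd
  | If of expr & cmd & cmd
  | While of expr & cmd.

Record state := State { reg : nat -> nat; arr : nat -> nat -> nat }.

Definition upd (A : Type) (f : nat -> A) (i : nat) (a : A) : nat -> A :=
  fun j => if j == i then a else f j.

Definition set_reg (s : state) (x v : nat) : state :=
  State (upd (reg s) x v) (arr s).

Definition set_arr (s : state) (a i v : nat) : state :=
  State (reg s) (upd (arr s) a (upd (arr s a) i v)).

Fixpoint eval (s : state) (e : expr) : nat :=
  match e with
  | Lit m => m
  | Reg x => reg s x
  | Get a e1 => arr s a (eval s e1)
  | Add e1 e2 => eval s e1 + eval s e2
  | Sub e1 e2 => eval s e1 - eval s e2
  end.

Fixpoint ecost (e : expr) : nat :=
  match e with
  | Lit _ | Reg _ => 1
  | Get _ e1 => (ecost e1).+1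
  | Add e1 e2 | Sub e1 e2 => (ecost e1 + ecost e2).+1
  end.

(* exec p s t s': run from state s, p halts in state s' after t unit-cost
   steps.  A condition holds when its value is nonzero. *)
Inductive exec : cmd -> state -> nat -> state -> Prop :=
  | ExSkip s : exec Skip s 1 s
  | ExAssign s x e : exec (Assign x e) s (ecost e).+1 (set_reg s x (eval s e))
  | ExPut s a ei ev :
      exec (Put a ei ev) s (ecost ei + ecost ev).+1
           (set_arr s a (eval s ei) (eval s ev))
  | ExSeq p q s s1 s2 t1 t2 :
      exec p s t1 s1 -> exec q s1 t2 s2 -> exec (Seq p q) s (t1 + t2) s2
  | ExIfT e p q s s1 t :
      eval s e != 0 -> exec p s t s1 -> exec (If e p q) s ((ecost e).+1 + t) s1
  | ExIfF e p q s s1 t :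
      eval s e = 0 -> exec q s t s1 -> exec (If e p q) s ((ecost e).+1 + t) s1
  | ExWhileT e p s s1 s2 t1 t2 :
      eval s e != 0 -> exec p s t1 s1 -> exec (While e p) s1 t2 s2 ->
      exec (While e p) s ((ecost e).+1 + t1 + t2) s2
  | ExWhileF e p s : eval s e = 0 -> exec (While e p) s (ecost e).+1 s.

(* The array f 0, ..., f (n - 1), 0, 0, ... *)
Definition tab n (f : 'I_n -> nat) (i : nat) : nat :=
  if insub i is Some v then f v else 0.

(* Registers 0, 1, 2 hold n, r, K; array 0 holds the capacities; array 1 holds
   the n x n adjacency matrix of G in row-major order; the rest is 0. *)
Definition mbrtp_input n (G : sgraph 'I_n) (r : 'I_n) (c : 'I_n -> nat) (K : nat)
    : state :=
  State (nth 0 [:: n; nat_of_ord r; K])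
        (fun a => match a with
         | 0 => tab c
         | 1 => fun i => tab (fun u => tab (fun v => nat_of_bool (edge G u v))
                                           (i %% n)) (i %/ n)
         | _ => fun=> 0
         end).

(* Array 2 holds the K x n matrix of the vertex sets V_k, and array 3 holds,
   consecutively, the n x n adjacency matrices of the edge sets E_k. *)
Definition mbrtp_output n K (s : state) (T : 'I_K -> sgraph 'I_n) : Prop :=
  forall (k : 'I_K) (u : 'I_n),
    arr s 2 (k * n + u) = (u \in verts (T k)) /\
    (forall v : 'I_n, arr s 3 ((k * n + u) * n + v) = edge (T k) u v).

Definition solves_mbrtp (p : cmd) n (G : sgraph 'I_n) (r : 'I_n)
    (c : 'I_n -> nat) (K : nat) (t : nat) : Prop :=
  exists (s : state) (T : 'I_K -> sgraph 'I_n),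
    [/\ exec p (mbrtp_input G r c K) t s,
        mbrtp_output s T &
        max_packing G r c T].

(* Main.v *)
Require Import Defs.
From mathcomp Require Import all_boot.
From mathcomp Require Import zify.
(* Importing Defs last makes Sub denote truncated subtraction of expressions
   rather than the subType constructor of eqtype. *)
Import Defs.

Set Implicit Arguments.
Unset Strict Implicit.
Unset Printing Implicit Defensive.

(* Let x u be the number of trees of a packing that contain u.  In a tree G
   rooted at r the children of v in T_k are the children of v in G that lie in
   T_k, so x satisfies x r = K, x u <= x (parent of u), and for each v the sum
   of x over the children of v is at most c v; conversely such an x comes from
   the packing with V_k = {u | k < x u}, and sum x is the size of the packing.
   The best x is found by a knapsack recurrence that treats the vertices other
   than r one at a time, in the reverse of a breadth-first order: opt l v j b is
   the best contribution of the children of v in the suffix l of this order when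
   x v = j and b units of c v are left.  Each of the n(K+1)(nK+1) table entries
   takes O(K) steps.  Optimality follows from a potential that never increases
   when the vertices are given their multiplicities in breadth-first order, and
   that is constant if every choice is an optimal one. *)

(** * Programs *)

(** Total correctness with an upper bound on the time: a bound, unlike the exact cost, can be chosen
    independently of the branches taken. *)
Definition ok (p : cmd) (s : state) (t : nat) (Q : state -> Prop) : Prop :=
  exists t' s', [/\ t' <= t, exec p s t' s' & Q s'].

Lemma ok_weaken p s t t' (Q Q' : state -> Prop) :
  ok p s t Q -> t <= t' -> (forall s', Q s' -> Q' s') -> ok p s t' Q'.
Proof.
move=> [t0 [s' [le_t ex q]]] le_t' QQ'.
by exists t0, s'; split; [exact: leq_trans le_t' | | exact: QQ'].
Qed.

Lemma ok_seq p q s t1 t2 (Q : state -> Prop) :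
  ok p s t1 (fun s' => ok q s' t2 Q) -> ok (Seq p q) s (t1 + t2) Q.
Proof.
move=> [t [s1 [le_t ex1 [t' [s2 [le_t' ex2 q2]]]]]].
by exists (t + t'), s2; split; [exact: leq_add | exact: ExSeq ex1 ex2 |].
Qed.

Fixpoint loopfree (p : cmd) : bool :=
  match p with
  | Seq p q | If _ p q => loopfree p && loopfree q
  | While _ _ => false
  | _ => true
  end.

(** The [While] case is a placeholder: [run] and [time] serve loop-free commands, where [time]
    charges both branches of a conditional and so does not depend on the state. *)
Fixpoint run (p : cmd) (s : state) : state :=
  match p with
  | Skip | While _ _ => s
  | Assign x e => set_reg s x (eval s e)
  | Put a e1 e2 => set_arr s a (eval s e1) (eval s e2)
  | Seq p q => run q (run p s)
  | If e p q => if eval s e == 0 then run q s else run p s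
  end.

Fixpoint time (p : cmd) : nat :=
  match p with
  | Skip | While _ _ => 1
  | Assign _ e => (ecost e).+1
  | Put _ e1 e2 => (ecost e1 + ecost e2).+1
  | Seq p q => time p + time q
  | If e p q => (ecost e).+1 + (time p + time q)
  end.

Lemma ok_run p s (Q : state -> Prop) :
  loopfree p -> Q (run p s) -> ok p s (time p) Q.
Proof.
move=> lp q; suff [t le_t ex]: exists2 t, t <= time p & exec p s t (run p s).
  by exists t, (run p s).
elim: p s lp {q} => [|x e|a e1 e2|p IHp q IHq|e p IHp q IHq|//] s /=.
- by exists 1 => //; exact: ExSkip.
- by exists (ecost e).+1 => //; exact: ExAssign.
- by exists (ecost e1 + ecost e2).+1 => //; exact: ExPut.
- move=> /andP[/(IHp s)[t1 le1 ex1] /(IHq (run p s))[t2 le2 ex2]].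
  by exists (t1 + t2); [exact: leq_add | exact: ExSeq ex1 ex2].
- move=> /andP[/(IHp s)[t1 le1 ex1] /(IHq s)[t2 le2 ex2]].
  case: eqP => [e0|/eqP e0].
    by exists ((ecost e).+1 + t2); [lia | exact: ExIfF].
  by exists ((ecost e).+1 + t1); [lia | exact: ExIfT].
Qed.

Fixpoint wreg (p : cmd) : seq nat :=
  match p with
  | Assign x _ => [:: x]
  | Seq p q | If _ p q => wreg p ++ wreg q
  | While _ p => wreg p
  | _ => [::]
  end.

Fixpoint warr (p : cmd) : seq nat :=
  match p with
  | Put a _ _ => [:: a]
  | Seq p q | If _ p q => warr p ++ warr q
  | While _ p => warr p
  | _ => [::]
  end.

Definition same (xs ys : seq nat) (s s' : state) : Prop :=
  (forall x, x \notin xs -> reg s' x = reg s x) /\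
  (forall a, a \notin ys -> arr s' a = arr s a).

Lemma same_trans xs ys s1 s2 s3 :
  same xs ys s1 s2 -> same xs ys s2 s3 -> same xs ys s1 s3.
Proof.
move=> [r1 a1] [r2 a2].
by split=> z zN; [rewrite r2 // r1 | rewrite a2 // a1].
Qed.

Lemma same_sub xs ys xs' ys' s s' :
  {subset xs <= xs'} -> {subset ys <= ys'} -> same xs ys s s' -> same xs' ys' s s'.
Proof.
by move=> sx sy [hr ha]; split=> z zN; [apply: hr | apply: ha];
  apply: contra zN; [exact: sx | exact: sy].
Qed.

Lemma same_widen xs ys xs' ys' s s' :
  all (fun x => x \in xs') xs -> all (fun a => a \in ys') ys ->
  same xs ys s s' -> same xs' ys' s s'.
Proof. by move=> /allP sx /allP sy; exact: same_sub. Qed.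

(** Registers and arrays are named by literals, so what a run may change can be read off the program
    text. This frame rule carries earlier facts past later phases without burdening the loop
    invariants. *)
Lemma exec_same p s t s' : exec p s t s' -> same (wreg p) (warr p) s s'.
Proof.
have subL (A B : seq nat) : {subset A <= A ++ B} by move=> z; rewrite mem_cat => ->.
have subR (A B : seq nat) : {subset B <= A ++ B} by move=> z; rewrite mem_cat orbC => ->.
elim=> {p s t s'} //=.
- move=> s x e; split=> //= z; rewrite inE /upd => /negPf.
  by move=> ->.
- by move=> s a e1 e2; split=> //= z; rewrite inE /upd => /negPf ->.
- move=> p q s s1 s2 t1 t2 _ h1 _ h2.
  by apply: same_trans (same_sub _ _ h1) (same_sub _ _ h2).
- by move=> e p q s s1 t _ _; apply: same_sub.
- by move=> e p q s s1 t _ _; apply: same_sub.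
- by move=> e p s s1 s2 t1 t2 _ _ h1 _; apply: same_trans.
Qed.

Lemma ok_same p s t (Q : state -> Prop) :
  ok p s t Q -> ok p s t (fun s' => same (wreg p) (warr p) s s' /\ Q s').
Proof.
by move=> [t' [s' [le_t ex q]]]; exists t', s'; split=> //; split=> //; exact: exec_same ex.
Qed.

Definition For (x : nat) (e : expr) (p : cmd) : cmd :=
  Seq (Assign x (Lit 0))
      (While (Sub e (Reg x)) (Seq p (Assign x (Add (Reg x) (Lit 1))))).

(** Each round pays [t] for the body, [ecost e + 3] for the test and 4 for the increment; the extra
    round in [N.+1] absorbs the initialization and the final test. The bound [e] is evaluated anew
    in every round, so its value must survive whatever the loop writes. *)
Lemma ok_for x e p s0 N t (I : nat -> state -> Prop) (Q : state -> Prop) :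
  let same0 := same (x :: wreg p) (warr p) s0 in
  x \notin wreg p ->
  (forall s, same0 s -> eval s e = N) ->
  I 0 (set_reg s0 x 0) ->
  (forall i s, i < N -> reg s x = i -> same0 s -> I i s ->
     ok p s t (fun s' => I i.+1 (set_reg s' x i.+1))) ->
  (forall s, reg s x = N -> same0 s -> I N s -> Q s) ->
  ok (For x e p) s0 (N.+1 * (t + ecost e + 7)) Q.
Proof.
move=> same0 xp eN I0 Istep IQ.
rewrite /For; set body := Seq p _.
suff loop i s : i <= N -> reg s x = i -> same0 s -> I i s ->
    ok (While (Sub e (Reg x)) body) s
       ((N - i) * (t + ecost e + 7) + (ecost e + 3)) Q.
  rewrite mulSn addnC; apply: ok_weaken (_ : ok _ _ (2 + _) _) _ (fun _ => id).
    apply: ok_seq; apply: ok_run => //=; apply: (loop 0) => //=.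
      by rewrite /upd eqxx.
    by split=> //= z; rewrite inE negb_or /upd => /andP[/negPf ->].
  by rewrite subn0; lia.
have [d] := ubnP (N - i); elim: d i s => // d IHd i s ltd le_iN xi ss Ii.
have Ee : eval s (Sub e (Reg x)) = N - i by rewrite /= eN ?xi.
case: (ltnP i N) => [lt_iN|le_Ni]; last first.
  have iN : i = N by apply/eqP; rewrite eqn_leq le_iN.
  exists (ecost (Sub e (Reg x))).+1, s; split; first by rewrite /=; lia.
    by apply: ExWhileF; rewrite Ee; lia.
  by apply: IQ; rewrite -?iN.
have [t1 [s1 [le1 ex1 [ss1 I1]]]] := ok_same (Istep i s lt_iN xi ss Ii).
have x1 : reg s1 x = i by rewrite (proj1 ss1).
have ss2 : same0 (set_reg s1 x i.+1).
  apply: (same_trans ss); split=> [z|z zN] /=; last exact: (proj2 ss1).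
  by rewrite inE negb_or /upd => /andP[/negPf -> /(proj1 ss1)].
have xi2 : reg (set_reg s1 x i.+1) x = i.+1 by rewrite /= /upd eqxx.
have ltd' : N - i.+1 < d by lia.
have [t2 [s2 [le2 ex2 Q2]]] := IHd i.+1 _ ltd' lt_iN xi2 ss2 I1.
exists ((ecost (Sub e (Reg x))).+1 + (t1 + 4) + t2), s2; split=> //.
  by rewrite /= (_ : N - i = (N - i.+1).+1) ?mulSn; lia.
apply: ExWhileT ex2; first by rewrite Ee; lia.
apply: ExSeq ex1 _.
have -> : set_reg s1 x i.+1 = set_reg s1 x (eval s1 (Add (Reg x) (Lit 1))).
  by rewrite /= x1 addn1.
exact: ExAssign.
Qed.

(** * The dynamic program *)

Section Recurrence.
Variables (V : eqType) (par : V -> V) (cap : V -> nat).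

(* The largest total multiplicity in the subtrees of those children of v that
   belong to l, when v has multiplicity j and b of its capacity is left for
   these children. *)
Fixpoint opt (l : seq V) (v : V) (j b : nat) : nat :=
  if l is u :: l' then
    if v == par u then
      \max_(k < (minn j b).+1) (k + opt l' u k (cap u) + opt l' v j (b - k))
    else opt l' v j b
  else 0.

Arguments opt : simpl never.

Definition best_choice (l : seq V) (u : V) (j b k : nat) : Prop :=
  k <= minn j b /\
  k + opt l u k (cap u) + opt l (par u) j (b - k) = opt (u :: l) (par u) j b.

Lemma opt_par l u j b :
  opt (u :: l) (par u) j b =
    \max_(k < (minn j b).+1) (k + opt l u k (cap u) + opt l (par u) j (b - k)).
Proof. by rewrite /opt eqxx. Qed.

Definition children_sum (l : seq V) (x : V -> nat) (v : V) : nat :=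
  \sum_(w <- l | par w == v) x w.

(** When parents come first, every undecided vertex hangs below exactly one vertex of [l1] through
    undecided ones, so this is the best total still attainable once [l1] is decided. *)
Definition potential (l1 l2 : seq V) (x rem : V -> nat) : nat :=
  \sum_(v <- l1) (x v + opt l2 v (x v) (rem v)).

(* Fixing the multiplicity of u changes the potential only through u and its
   parent. *)
Lemma potential_rcons l1 u l2 (x rem rem' : V -> nat) :
  uniq (rcons l1 u) -> par u \in l1 ->
  rem' u = cap u -> rem' (par u) = rem (par u) - x u ->
  (forall v, v \in l1 -> v != par u -> rem' v = rem v) ->
  potential (rcons l1 u) l2 x rem'
    + opt (u :: l2) (par u) (x (par u)) (rem (par u)) =
  potential l1 (u :: l2) x rem
    + (x u + opt l2 u (x u) (cap u)
         + opt l2 (par u) (x (par u)) (rem (par u) - x u)).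
Proof.
rewrite rcons_uniq => /andP[ul uq] pl ru rp rv.
have rest : \sum_(v <- l1 | v != par u) (x v + opt (u :: l2) v (x v) (rem v)) =
            \sum_(v <- l1 | v != par u) (x v + opt l2 v (x v) (rem' v)).
  rewrite big_seq_cond [RHS]big_seq_cond; apply: eq_bigr => v /andP[vl vp].
  by rewrite /opt -/opt (negPf vp) rv.
rewrite /potential big_rcons ru !(bigD1_seq (par u) pl uq) rest rp /=.
lia.
Qed.

Lemma potential_best_choice l1 u l2 (x rem rem' : V -> nat) :
  uniq (rcons l1 u) -> par u \in l1 ->
  rem' u = cap u -> rem' (par u) = rem (par u) - x u ->
  (forall v, v \in l1 -> v != par u -> rem' v = rem v) ->
  best_choice l2 u (x (par u)) (rem (par u)) (x u) ->
  potential (rcons l1 u) l2 x rem' = potential l1 (u :: l2) x rem.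
Proof.
move=> uq pl ru rp rv [_ bc].
have := potential_rcons l2 uq pl ru rp rv; rewrite bc.
exact: addIn.
Qed.

Lemma potential_nil l1 x rem : potential l1 [::] x rem = \sum_(v <- l1) x v.
Proof. by apply: eq_bigr => v _ /=; rewrite addn0. Qed.

Definition parents_first (r : V) (l : seq V) : Prop :=
  forall l1 u l2, l = l1 ++ u :: l2 -> par u \in r :: l1.

(** Given out in order, each [x u] is one candidate of the maximum in [opt], so the potential never
    increases. It starts at the right-hand side and ends, with nothing undecided, at the sum of
    [x]. *)
Lemma opt_upper r l (x : V -> nat) :
  uniq (r :: l) -> parents_first r l ->
  (forall u, u \in l -> x u <= x (par u)) ->
  (forall v, v \in r :: l -> children_sum l x v <= cap v) ->
  \sum_(v <- r :: l) x v <= x r + opt l r (x r) (cap r).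
Proof.
move=> uql pf mono xc.
pose rem l1 v := cap v - children_sum l1 x v.
suff main l1 l2 : l1 ++ l2 = l ->
    \sum_(v <- r :: l) x v <= potential (r :: l1) l2 x (rem l1).
  have := main [::] l erefl; rewrite /potential big_seq1 /rem.
  by rewrite /children_sum [in X in _ <= X -> _]big_nil subn0.
elim: l2 l1 => [|u l2 IH] l1 ell.
  by rewrite potential_nil -ell cats0.
have pu : par u \in r :: l1 by apply: (pf _ _ l2).
have uqu : uniq (rcons (r :: l1) u).
  by move: uql; rewrite -ell -cat_rcons -cat_cons cat_uniq => /andP[].
have ul : u \in l by rewrite -ell mem_cat inE eqxx orbT.
have pul : par u \in r :: l.
  by move: pu; rewrite -ell !inE mem_cat => /orP[->|->]; rewrite ?orbT.
apply: leq_trans (IH (rcons l1 u) _) _; first by rewrite cat_rcons.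
have cs v : children_sum (rcons l1 u) x v =
    children_sum l1 x v + (if par u == v then x u else 0).
  by rewrite /children_sum -cats1 big_cat /= big_cons big_nil addn0.
rewrite -(leq_add2r (opt (u :: l2) (par u) (x (par u)) (rem l1 (par u)))).
rewrite -rcons_cons (@potential_rcons _ _ _ x (rem l1)) // ?leq_add2l.
- rewrite opt_par; apply: (@leq_bigmax_cond _ xpredT
    (fun k : 'I__ => k + opt l2 u k (cap u)
                     + opt l2 (par u) (x (par u)) (rem l1 (par u) - k)) (Ordinal _)) => //.
  (* [x u] lies in the range of the maximum: it is at most the multiplicity of the parent, and
     together with the earlier siblings it fits into the parent's capacity. *)
  rewrite ltnS leq_min mono //= /rem leq_subRL; last first.
    apply: leq_trans (xc _ pul); rewrite -ell /children_sum big_cat.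
    exact: leq_addr.
  apply: leq_trans (xc _ pul); rewrite -ell /children_sum big_cat leq_add2l.
  by rewrite big_cons eqxx leq_addr.
- rewrite /rem cs; have [eu|_] := eqVneq (par u) u.
    by move: uqu; rewrite rcons_uniq -[X in X \notin _]eu pu.
  rewrite addn0 (_ : children_sum l1 x u = 0) ?subn0 //.
  (* A child [w] of [u] in [l1] would put [u] itself into [r :: l1], against uniqueness; hence [u]
     starts with its full capacity. *)
  rewrite /children_sum big_seq_cond big1 // => w /andP[wl /eqP pw].
  have [l11 [l12 el1]] : exists l11 l12, l1 = l11 ++ w :: l12.
    by case/splitPr: wl => a b; exists a, b.
  move: uqu; rewrite rcons_uniq -pw => /andP[/negP[]].
  have: par w \in r :: l11 by apply: (pf _ _ (l12 ++ u :: l2)); rewrite -ell el1 -catA.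
  by rewrite el1 !inE mem_cat => /orP[->|->]; rewrite ?orbT.
- by rewrite /rem cs eqxx subnDA.
- by move=> v _ vp; rewrite /rem cs eq_sym (negPf vp) addn0.
Qed.

End Recurrence.

Section Trace.
Variables (par cap : nat -> nat) (r K : nat) (l : seq nat).

(** Invariant of the top-down pass. The last clause keeps the potential at its initial value, so
    that at the end, with [l2] empty, the total of [x] meets the bound of [opt_upper]. *)
Definition traced (l1 l2 : seq nat) (x rem : nat -> nat) : Prop :=
  [/\ x r = K,
      forall v, v \in r :: l1 -> x v <= K,
      forall v, v \in r :: l1 -> rem v + children_sum par l1 x v = cap v,
      forall w, w \in l1 -> x w <= x (par w) &
      potential par cap (r :: l1) l2 x rem = K + opt par cap l r K (cap r)].

Lemma traced_init x rem : x r = K -> rem r = cap r -> traced [::] l x rem.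
Proof.
move=> xr rr; split=> // [v|v|].
- by rewrite inE => /eqP->; rewrite xr.
- by rewrite inE => /eqP->; rewrite rr /children_sum big_nil addn0.
- by rewrite /potential big_seq1 xr rr.
Qed.

Lemma traced_rcons l1 u l2 x rem k :
  uniq (r :: l) -> parents_first par r l -> l = l1 ++ u :: l2 ->
  best_choice par cap l2 u (x (par u)) (rem (par u)) k ->
  traced l1 (u :: l2) x rem ->
  traced (rcons l1 u) l2 (upd x u k) (upd (upd rem (par u) (rem (par u) - k)) u (cap u)).
Proof.
move=> uql pf ell bc [xr xK remE mono pot].
have pu : par u \in r :: l1 by apply: (pf _ _ l2).
have uqu : uniq (rcons (r :: l1) u).
  by move: uql; rewrite ell -cat_rcons -cat_cons cat_uniq => /andP[].
have uN : u \notin r :: l1 by move: uqu; rewrite rcons_uniq => /andP[].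
have neq v : v \in r :: l1 -> (v == u) = false.
  by move=> vl; apply: contraNF uN => /eqP <-.
have parl w : w \in l1 -> par w \in r :: l1.
  move=> wl; have [l11 [l12 el1]] : exists l11 l12, l1 = l11 ++ w :: l12.
    by case/splitPr: wl => a b; exists a, b.
  have: par w \in r :: l11 by apply: (pf _ _ (l12 ++ u :: l2)); rewrite ell el1 -catA.
  by rewrite el1 !inE mem_cat => /orP[->|->]; rewrite ?orbT.
have updx v : v \in r :: l1 -> upd x u k v = x v by move=> /neq vu; rewrite /upd vu.
have tl w : w \in l1 -> w \in r :: l1 by rewrite inE orbC => ->.
have cs v : children_sum par (rcons l1 u) (upd x u k) v =
    children_sum par l1 x v + (if par u == v then k else 0).
  rewrite /children_sum -cats1 big_cat /= big_cons big_nil addn0 {2}/upd eqxx.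
  congr (_ + _); rewrite big_seq_cond [RHS]big_seq_cond; apply: eq_bigr => w /andP[wl _].
  by rewrite updx ?tl.
have xu : upd x u k u = k by rewrite /upd eqxx.
have [kle _] := bc; move: kle; rewrite leq_min => /andP[kx krem].
(* The potential reads [x] at decided vertices only, so [x u] may be stored before [u] leaves the
   undecided ones. *)
have potE : potential par cap (r :: l1) (u :: l2) (upd x u k) rem =
            potential par cap (r :: l1) (u :: l2) x rem.
  by rewrite /potential big_seq [RHS]big_seq; apply: eq_bigr => v vl; rewrite updx.
split=> [|v|v|w|].
- by rewrite updx ?mem_head.
- rewrite -rcons_cons mem_rcons inE => /orP[/eqP->|vl].
    by rewrite xu (leq_trans kx) // xK.
  by rewrite updx // xK.
- rewrite -rcons_cons mem_rcons inE cs => /orP[/eqP->|vl].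
    rewrite {1}/upd eqxx (eq_sym (par u)) [u == _]eq_sym neq // addn0.
    rewrite /children_sum big_seq_cond big1 ?addn0 // => w /andP[wl /eqP pw].
    by have := neq _ (parl w wl); rewrite pw eqxx.
  rewrite {1}/upd neq // /upd [par u == v]eq_sym.
  have := remE v vl; case: eqP => [->|_]; lia.
- rewrite mem_rcons inE => /orP[/eqP->|wl]; first by rewrite xu updx.
  by rewrite !updx ?parl ?tl // mono.
- rewrite -pot -rcons_cons -potE; apply: potential_best_choice => //.
  + by rewrite /upd eqxx.
  + by rewrite xu /upd neq // eqxx.
  + by move=> v vl vp; rewrite /upd neq // (negPf vp).
  + by rewrite xu updx.
Qed.

End Trace.

(** * The machine program *)

(* Registers 5, 6, 7 hold nK, nK + 1 and (K + 1)(nK + 1); arrays 4, 12, 11 hold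
   the multiples of n, nK + 1 and (K + 1)(nK + 1), since the machine cannot
   multiply.  Array 5 is the breadth-first order, 6 the parent of a vertex, and 7
   marks the visited vertices; register 8 is the number of these.  Arrays 8 and
   9 consist of n + 1 rows of (K + 1)(nK + 1) entries: row u + 1, written when u
   is processed, holds the values of the recurrence for the parent of u (array
   8) and the optimal multiplicities of u (array 9); array 10 gives the row that
   is current for a vertex.  Row 0 is never written, hence it is the zero row
   that the initial zeros of array 10 refer to.  Arrays 13 and 14 hold the
   multiplicities and the capacities that are left. *)

Arguments upd A f i a j /.

Definition multiples (a x : nat) (e : expr) : cmd :=
  Seq (Assign 3 (Lit 0))
      (For 4 e (Seq (Put a (Reg 4) (Reg 3)) (Assign 3 (Add (Reg 3) (Reg x))))).

Lemma ok_multiples a x e s N m :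
  x \notin [:: 3; 4] -> reg s x = m ->
  (forall s', same [:: 3; 4] [:: a] s s' -> eval s' e = N) ->
  ok (multiples a x e) s (2 + N.+1 * (14 + ecost e))
     (fun s' => [/\ same [:: 3; 4] [:: a] s s', reg s' 3 = N * m &
                    forall i, i < N -> arr s' a i = i * m]).
Proof.
rewrite !inE negb_or => /andP[x3 x4] xm eN.
pose Q s' := reg s' 3 = N * m /\ forall i, i < N -> arr s' a i = i * m.
have H : ok (multiples a x e) s (2 + N.+1 * (7 + ecost e + 7)) Q.
  apply: ok_seq; apply: ok_run => //=.
  apply: (ok_for (N := N) (t := 7)
    (I := fun i s' => reg s' 3 = i * m /\ forall j, j < i -> arr s' a j = j * m)) => //=.
  - move=> s' [sr sa]; apply: eN; split=> z zN; last by rewrite sa.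
    move: zN; rewrite !inE negb_or => /andP[z3 z4].
    by rewrite sr ?inE /= /upd ?(negPf z3) ?(negPf z4).
  - move=> i s' lt_iN s'i [sr sa] [q3 qa].
    have xm' : reg s' x = m.
      by rewrite sr ?inE /= /upd ?(negPf x3) ?(negPf x4).
    apply: ok_run => //=; rewrite /upd /= eqxx s'i q3 xm'.
    split=> [|j]; first by lia.
    by rewrite ltnS leq_eqVlt; case: eqP => [->|] //= _ /qa.
apply: ok_weaken (ok_same H) _ _; first by lia.
by move=> s' [ss [q3 qa]]; split=> //; apply: same_sub ss => z; rewrite !inE // => /or4P[]->; rewrite ?orbT.
Qed.

Definition tables (n K : nat) (s : state) : Prop :=
  [/\ [/\ reg s 0 = n, reg s 2 = K, reg s 5 = n * K & reg s 6 = (n * K).+1],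
      forall i, i < n -> arr s 4 i = i * n,
      forall j, j <= K -> arr s 12 j = j * (n * K).+1 &
      forall i, i <= n -> arr s 11 i = i * (K.+1 * (n * K).+1)].

Lemma tables_same n K xs ys s s' :
  same xs ys s s' -> all (fun x => x \notin xs) [:: 0; 2; 5; 6] ->
  all (fun a => a \notin ys) [:: 4; 11; 12] -> tables n K s -> tables n K s'.
Proof.
move=> [sr sa] /= /and5P[x0 x2 x5 x6 _] /and4P[a4 a11 a12 _] [[r0 r2 r5 r6] t4 t12 t11].
split; first by split; rewrite sr.
- by move=> i /t4; rewrite sa.
- by move=> i /t12; rewrite sa.
- by move=> i /t11; rewrite sa.
Qed.

(** Array 4 extends to index n + K - 1 so that its entry K supplies the product nK; (K + 1)(nK + 1)
    is the running sum that the second [multiples] leaves in register 3. *)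
Definition setup : cmd :=
  Seq (multiples 4 0 (Add (Reg 0) (Reg 2)))
 (Seq (Seq (Assign 5 (Get 4 (Reg 2))) (Assign 6 (Add (Reg 5) (Lit 1))))
 (Seq (multiples 12 6 (Add (Reg 2) (Lit 1)))
 (Seq (Assign 7 (Reg 3))
      (multiples 11 7 (Add (Reg 0) (Lit 1)))))).

Lemma ok_setup n K s :
  0 < n -> reg s 0 = n -> reg s 2 = K ->
  ok setup s (15 + (n + K.+1 + K.+2 + n.+2) * 17)
     (fun s' => same (wreg setup) (warr setup) s s' /\ tables n K s').
Proof.
move=> n0 r0 r2; apply: ok_same.
apply: ok_weaken (_ : ok _ _ (_ + (_ + (_ + (_ + _)))) _) _ (fun _ => id).
  apply: ok_seq; apply: ok_weaken (ok_multiples (N := n + K) _ r0 _) (leqnn _) _ => //.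
    by move=> s' [sr _] /=; rewrite !sr // r0 r2.
  move=> s1 [[sr1 sa1] _ t4].
  apply: ok_seq; apply: ok_run => //=.
  set s2 := set_reg _ _ _.
  have r5 : reg s2 5 = n * K by rewrite /= sr1 // r2 t4 1?mulnC //; lia.
  have r6 : reg s2 6 = (n * K).+1 by rewrite /= sr1 // r2 t4; lia.
  have rr0 : reg s2 0 = n by rewrite /= sr1.
  have rr2 : reg s2 2 = K by rewrite /= sr1.
  have t4' : forall i, i < n -> arr s2 4 i = i * n by move=> i lt_in; apply: t4; lia.
  move: s2 r5 r6 rr0 rr2 t4' => {sr1 sa1 t4} s2 r5 r6 rr0 rr2 t4.
  apply: ok_seq; apply: ok_weaken (ok_multiples (N := K.+1) _ r6 _) (leqnn _) _ => //.
    by move=> s' [sr _] /=; rewrite !sr // rr2 addn1.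
  move=> s3 [[sr3 sa3] r3 t12].
  apply: ok_seq; apply: ok_run => //=.
  set s4 := set_reg _ _ _; have r7 : reg s4 7 = K.+1 * (n * K).+1 by [].
  apply: ok_weaken (ok_multiples (N := n.+1) _ r7 _) (leqnn _) _ => //.
    by move=> s' [sr _] /=; rewrite !sr //= sr3 // rr0 addn1.
  move=> s5 [[sr5 sa5] _ t11].
  split; first by split; rewrite sr5 //= sr3.
  - by move=> i lt_in; rewrite sa5 //= sa3 // t4.
  - by move=> j le_jK; rewrite sa5 //= t12.
  - by move=> i le_in; apply: t11.
by rewrite /=; lia.
Qed.

(** * Breadth-first search from the root *)

Section Search.
Variables (n r : nat) (A : nat -> nat -> bool).
Hypothesis lt_rn : r < n.

(* o lists the t vertices that have been visited. *)
Definition grown (o p vis : nat -> nat) (t : nat) : Prop :=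
  [/\ [/\ 0 < t, o 0 = r & uniq (mkseq o t)],
      forall a, a < t -> o a < n,
      forall v, v < n -> vis v = (v \in mkseq o t) &
      forall a, 0 < a < t -> exists b, [/\ b < a, p (o a) = o b & A (o b) (o a)]].

Definition scanned (o vis : nat -> nat) (i : nat) : Prop :=
  forall a v, a < i -> v < n -> A (o a) v -> vis v = 1.

Lemma grown_size o p vis t : grown o p vis t -> t <= n.
Proof.
move=> [[_ _ uq] on _ _]; rewrite -[t](size_mkseq o) -[leqRHS](size_iota 0).
apply: uniq_leq_size => // v /mapP[a]; rewrite !mem_iota /= !add0n => at_ ->.
exact: on.
Qed.

Lemma grown_init o p vis :
  (forall v, v < n -> vis v = 0) -> grown (upd o 0 r) p (upd vis r 1) 1.
Proof.
move=> vis0; split=> [//|a|v vn|a]; last by lia.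
- by rewrite ltnS leqn0 => /eqP->.
- by rewrite /= inE vis0 //; case: eqP.
Qed.

Lemma grown_visit o p vis t i v :
  grown o p vis t -> i < t -> v < n -> A (o i) v -> vis v = 0 ->
  grown (upd o t v) (upd p v (o i)) (upd vis v 1) t.+1.
Proof.
move=> [[t0 o0 uq] on visE par] it vn Aiv v0.
have vN : v \notin mkseq o t by have := visE v vn; rewrite v0; case: (_ \in _).
have oN a : a < t -> (o a == v) = false.
  by move=> lt_at; apply: contraNF vN => /eqP <-; apply: map_f; rewrite mem_iota.
have mk : mkseq (upd o t v) t.+1 = rcons (mkseq o t) v.
  rewrite mkseqS /= eqxx; congr rcons; apply/eq_in_map => a.
  by rewrite mem_iota /= add0n => /ltn_eqF ->.
split; rewrite ?mk.
- by rewrite rcons_uniq vN uq /= eq_sym (gtn_eqF t0).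
- by move=> a; rewrite ltnS leq_eqVlt /=; case: eqP => //= _; exact: on.
- by move=> w wn; rewrite mem_rcons inE /=; case: eqP => //= _; exact: visE.
- move=> a /andP[a0]; rewrite ltnS leq_eqVlt => /orP[/eqP->|lt_at].
    by exists i; rewrite /= !eqxx (ltn_eqF it).
  have [|b [ba pa Aba]] := par a; first by rewrite a0.
  exists b; rewrite /= (ltn_eqF lt_at) (oN a lt_at).
  by rewrite (ltn_eqF (ltn_trans ba lt_at)).
Qed.

Lemma scanned_visit o vis t i v :
  i <= t -> scanned o vis i -> scanned (upd o t v) (upd vis v 1) i.
Proof.
move=> it sc a w ai wn /=; rewrite (ltn_eqF (leq_trans ai it)) => Aaw.
by case: eqP => // _; exact: sc Aaw.
Qed.

(** Connectedness as an induction principle for sets closed under adjacency, so that the search on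
    natural numbers needs no paths. *)
Definition reachable_all : Prop :=
  forall S : nat -> bool, S r ->
    (forall u v, u < n -> v < n -> S u -> A u v -> S v) -> forall v, v < n -> S v.

(** Once the whole queue has been scanned, the visited vertices contain [r] and are closed under
    adjacency, so they are all n vertices. *)
Lemma scanned_all o p vis t i :
  reachable_all -> grown o p vis t -> scanned o vis i -> t <= i -> t = n.
Proof.
move=> conn gr sc ti; apply/eqP; rewrite eqn_leq (grown_size gr) /=.
move: gr => [[t0 o0 uq] on visE _].
have mem_o a : a < t -> o a \in mkseq o t by move=> lt_at; apply: map_f; rewrite mem_iota.
rewrite -[leqLHS](size_iota 0) -[leqRHS](size_mkseq o).
apply: uniq_leq_size (iota_uniq _ _) _ => v; rewrite mem_iota add0n /= => vn.
apply: (conn (fun v => v \in mkseq o t)) => // [|u w un wn]; first by rewrite -o0 mem_o.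
move=> /mapP[a]; rewrite mem_iota add0n /= => lt_at -> Aw.
by have := visE w wn; rewrite (sc a w) //; [case: (_ \in _) | lia].
Qed.

(** On 0/1 entries, truncated subtraction is the test for being adjacent and not yet visited. *)
Definition visit : cmd :=
  If (Sub (Get 1 (Add (Get 4 (Reg 11)) (Reg 10))) (Get 7 (Reg 10)))
     (Seq (Put 5 (Reg 8) (Reg 10))
     (Seq (Put 6 (Reg 10) (Reg 11))
     (Seq (Put 7 (Reg 10) (Lit 1))
          (Assign 8 (Add (Reg 8) (Lit 1))))))
     Skip.

Definition scan : cmd := For 10 (Reg 0) visit.

Definition search_init : cmd :=
  Seq (Put 5 (Lit 0) (Reg 1)) (Seq (Put 7 (Reg 1) (Lit 1)) (Assign 8 (Lit 1))).

Definition search : cmd :=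
  Seq search_init (For 9 (Reg 0) (Seq (Assign 11 (Get 5 (Reg 9))) scan)).

Definition adjacency (s : state) : Prop :=
  forall u v, u < n -> v < n -> arr s 1 (u * n + v) = A u v.

Definition grown_state (s : state) : Prop :=
  grown (arr s 5) (arr s 6) (arr s 7) (reg s 8).

Lemma ok_scan K s i :
  tables n K s -> adjacency s -> grown_state s -> scanned (arr s 5) (arr s 7) i ->
  i < reg s 8 -> reg s 11 = arr s 5 i ->
  ok scan s (n.+1 * (time visit + 8))
     (fun s' => grown_state s' /\ scanned (arr s' 5) (arr s' 7) i.+1).
Proof.
move=> tab adj gr sc it ri.
pose I v s' := [/\ grown_state s', scanned (arr s' 5) (arr s' 7) i,
  i < reg s' 8, arr s' 5 i = reg s 11 &
  forall w, w < v -> A (reg s 11) w -> arr s' 7 w = 1].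
apply: ok_weaken (ok_for (N := n) (t := time visit) (I := I) _ _ _ _ _) _ (fun _ => id) => //.
- by move=> s' [sr _] /=; rewrite sr //; case: tab => -[].
- move=> v s' vn rv ss [gr' sc' it' oi seen].
  have tab' : tables n K s' by apply: (tables_same ss _ _ tab).
  have adj' : adjacency s' by move=> u w un wn; rewrite (proj2 ss) //; exact: adj.
  have r11 : reg s' 11 = reg s 11 by rewrite (proj1 ss).
  have oin : reg s 11 < n by rewrite -oi; case: gr' => _ on _ _; exact: on.
  have visE : forall w, w < n -> arr s' 7 w = (w \in mkseq (arr s' 5) (reg s' 8)).
    by case: gr'.
  apply: ok_run => //=; rewrite r11 rv; case: tab' => _ t4 _ _; rewrite t4 //.
  rewrite adj' //.
  case: eqP => [unchanged|changed].
    split=> //= w; rewrite ltnS leq_eqVlt => /orP[/eqP->|]; last exact: seen.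
    by move=> Av; move: unchanged; rewrite Av visE //; case: (_ \in _).
  have Av : A (reg s 11) v by move: changed; case: (A _ v) => //=; lia.
  have v0 : arr s' 7 v = 0 by move: changed; rewrite Av visE //; case: (_ \in _).
  split=> //=; rewrite ?addn1.
  + rewrite /grown_state /= ?addn1 -oi; apply: grown_visit => //; by rewrite oi.
  + exact: scanned_visit (ltnW it') sc'.
  + exact: leqW.
  + by rewrite (ltn_eqF it').
  + move=> w; rewrite ltnS leq_eqVlt => /orP[/eqP->|wv Aw]; first by rewrite eqxx.
    by case: ifP => // _; apply: seen.
- move=> s' _ _ [gr' sc' it' oi seen]; split=> // a v.
  rewrite ltnS leq_eqVlt => /orP[/eqP->|ai] vn; last exact: sc'.
  by rewrite oi; exact: seen.
Qed.

Lemma ok_search K s :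
  reachable_all -> tables n K s -> adjacency s -> reg s 1 = r ->
  (forall v, arr s 7 v = 0) ->
  ok search s (time search_init + n.+1 * (n.+1 * (time visit + 8) + 11))
     (fun s' => grown (arr s' 5) (arr s' 6) (arr s' 7) n).
Proof.
move=> conn tab adj r1 vis0; apply: ok_seq; apply: ok_run => //.
set s1 := run _ s; set scan_time := n.+1 * (_ + 8).
have ss1 : same [:: 8] [:: 5; 7] s s1.
  by split=> z /=; rewrite ?inE; do ?[case: eqP => //].
pose I i s' := grown_state s' /\ scanned (arr s' 5) (arr s' 7) i.
apply: ok_weaken (ok_for (N := n) (t := 3 + scan_time) (I := I) _ _ _ _ _) _ (fun _ => id) => //.
- by move=> s' [sr _] /=; rewrite sr // (proj1 ss1) //; case: tab => -[].
- split=> //=; rewrite /grown_state /= r1; apply: grown_init => v _; exact: vis0.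
- move=> i s' lt_in ri ss [gr sc].
  (* The queue cannot run out before round n: an exhausted queue would hold all n vertices, yet have
     at most [i] < n entries. *)
  have it : i < reg s' 8.
    by rewrite ltnNge; apply/negP => le_ti; have := scanned_all conn gr sc le_ti; lia.
  apply: ok_seq; apply: ok_run => //=; rewrite ri.
  have tab' : tables n K s' by apply: (tables_same ss) => //; apply: (tables_same ss1 _ _ tab).
  apply: ok_weaken (ok_scan (K := K) (i := i) _ _ _ _ _ _) (leqnn _) _ => //.
  by move=> u v un vn /=; rewrite (proj2 ss) // (proj2 ss1) // adj.
- move=> s' _ _ [gr sc]; have := gr; rewrite /grown_state.
  by rewrite (scanned_all conn gr sc (grown_size gr)).
- rewrite /=; lia.
Qed.

End Search.

(** * One row of the recurrence table *)

Definition choice_value : expr :=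
  Add (Add (Reg 18) (Get 8 (Add (Reg 22) (Add (Get 12 (Reg 18)) (Reg 15)))))
      (Get 8 (Add (Reg 23) (Add (Get 12 (Reg 16)) (Sub (Reg 17) (Reg 18))))).

(** The test also succeeds on ties, so the candidate 0 is recorded even if its value is 0, and after
    the first round register 20 holds a genuine candidate. *)
Definition improve : cmd :=
  Seq (Assign 21 choice_value)
      (If (Sub (Add (Reg 21) (Lit 1)) (Reg 19))
          (Seq (Assign 19 (Reg 21)) (Assign 20 (Reg 18))) Skip).

(** The loop bound is min(j, b) + 1, because j - (j - b) is the minimum in truncated arithmetic. *)
Definition choose_loop : cmd :=
  For 18 (Sub (Add (Reg 16) (Lit 1)) (Sub (Reg 16) (Reg 17))) improve.

Lemma ok_choose_loop s j b g :
  reg s 16 = j -> reg s 17 = b -> reg s 19 = 0 ->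
  (forall s' k, same [:: 18; 19; 20; 21] [::] s s' -> reg s' 18 = k ->
     k <= minn j b -> eval s' choice_value = g k) ->
  ok choose_loop s (j.+2 * (time improve + 14))
     (fun s' => [/\ reg s' 20 <= minn j b, reg s' 19 = g (reg s' 20) &
                    forall k, k <= minn j b -> g k <= reg s' 19]).
Proof.
move=> rj rb r19 gE.
pose I k s' := [/\ k = 0 -> reg s' 19 = 0,
  0 < k -> reg s' 20 < k /\ reg s' 19 = g (reg s' 20) &
  forall k', k' < k -> g k' <= reg s' 19].
apply: ok_weaken (ok_for (N := (minn j b).+1) (t := time improve) (I := I) _ _ _ _ _) _ (fun _ => id) => //.
- by move=> s' [sr _] /=; rewrite !sr // rj rb; lia.
- move=> k s' lek rk [sr sa] [I0 I1 I2]; apply: ok_run => //.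
  have ss : same [:: 18; 19; 20; 21] [::] s s'.
    split=> z zN; last exact: sa.
    by apply: sr; move: zN; rewrite /= !inE; do ?[case: eqP => //=].
  have := gE s' k ss rk lek; rewrite /improve /choice_value /= => ->.
  case: ifP => [/eqP lt|ge]; split=> //= [_|k'].
  + by have := I1; case: (k) I0 I1 lt => [/(_ erefl)|k'] *; [lia|split; lia].
  + by rewrite ltnS leq_eqVlt => /orP[/eqP->|/I2//]; lia.
  + by rewrite rk.
  + by rewrite ltnS leq_eqVlt => /orP[/eqP->//|/I2]; lia.
- move=> s' _ _ [_ /(_ isT)[k20 e19] max].
  by split=> // k kle; apply: max.
- by rewrite leq_mul //=; lia.
Qed.

Section Fill.
Variables (n K : nat) (par cap : nat -> nat) (l : seq nat) (u cu cp : nat).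
Hypothesis cap_le : forall v, cap v <= n * K.

Let B1 := (n * K).+1.
Let W := K.+1 * B1.

Definition table_cell : expr := Add (Reg 24) (Add (Get 12 (Reg 16)) (Reg 17)).

Definition fill_cell : cmd :=
  Seq (Seq (Assign 19 (Lit 0)) (Assign 20 (Lit 0)))
 (Seq choose_loop
      (Seq (Put 8 table_cell (Reg 19)) (Put 9 table_cell (Reg 20)))).

Definition fill : cmd := For 16 (Add (Reg 2) (Lit 1)) (For 17 (Reg 6) fill_cell).

(** Registers 22 and 23 are the offsets of the rows current for [u] and for its parent. The row of
    [u] is read only in column [cap u], since the children of [u] start with its whole capacity; the
    parent's row is read in every column. *)
Definition fill_ready (s : state) : Prop :=
  [/\ tables n K s,
      [/\ reg s 15 = cap u, reg s 22 = cu * W, reg s 23 = cp * W & reg s 24 = u.+1 * W],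
      forall k, k <= K -> arr s 8 (cu * W + (k * B1 + cap u)) = opt par cap l u k (cap u) &
      forall j b, j <= K -> b <= n * K ->
        arr s 8 (cp * W + (j * B1 + b)) = opt par cap l (par u) j b].

(** The pair (j, b) is coded as the offset [f] = j(nK + 1) + b, so that the two nested loops advance
    one linear measure. *)
Definition filled (s : state) (f : nat) : Prop :=
  arr s 8 (u.+1 * W + f) = opt par cap (u :: l) (par u) (f %/ B1) (f %% B1) /\
  best_choice par cap l u (f %/ B1) (f %% B1) (arr s 9 (u.+1 * W + f)).

Definition fill_progress (s : state) (f : nat) (s' : state) : Prop :=
  (forall f', f' < f -> filled s' f') /\
  (forall q, q < u.+1 * W \/ u.+1 * W + f <= q ->
     arr s' 8 q = arr s 8 q /\ arr s' 9 q = arr s 9 q).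

Definition cell_time := 4 + (K.+2 * (time improve + 14) + 16).

Lemma ok_fill_cell s0 s j b :
  fill_ready s -> reg s 16 = j -> reg s 17 = b -> j <= K -> b <= n * K ->
  fill_progress s0 (j * B1 + b) s ->
  ok fill_cell s cell_time (fill_progress s0 (j * B1 + b).+1).
Proof.
move=> [[[r0 r2 r5 r6] t4 t12 t11] [r15 r22 r23 r24] Tu Tp] rj rb jK bB [done rest].
pose g k := k + opt par cap l u k (cap u) + opt par cap l (par u) j (b - k).
apply: ok_seq; apply: ok_run => //; set s1 := run _ s.
have gE s' k : same [:: 18; 19; 20; 21] [::] s1 s' -> reg s' 18 = k ->
    k <= minn j b -> eval s' choice_value = g k.
  move=> [sr sa] rk; rewrite leq_min => /andP[kj kb] /=.
  rewrite rk !sr //= !sa //= r22 r15 r23 rj rb !t12 // ?(leq_trans kj) //.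
  by rewrite Tu ?(leq_trans kj) // Tp // (leq_trans (leq_subr _ _)).
have H := ok_same (@ok_choose_loop s1 j b g rj rb erefl gE).
apply: ok_seq; apply: ok_weaken H _ _ => [|s2 [[sr sa] [kle best max]]].
  by rewrite leq_mul2r !ltnS jK orbT.
apply: ok_run => //=.
have optE : reg s2 19 = opt par cap (u :: l) (par u) j b.
  rewrite opt_par; apply/eqP; rewrite eqn_leq; apply/andP; split.
    rewrite best; rewrite -ltnS in kle.
    by apply: (@leq_bigmax_cond _ xpredT (fun k : 'I__ => g k) (Ordinal kle)).
  by apply/bigmax_leqP => k _; apply: max; rewrite -ltnS.
rewrite (sr 24) // (sr 16) // (sr 17) // sa //= r24 rj rb t12 // -/B1; split=> [f'|q] /=.
  rewrite ltnS leq_eqVlt /filled /= eqn_add2l => /orP[/eqP->|lt_f].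
    rewrite eqxx divnMDl // modnMDl divn_small // modn_small // addn0.
    by split=> //; split=> //; rewrite -optE best.
  by rewrite (ltn_eqF lt_f) !sa //; exact: done.
move=> qout; rewrite (_ : (q == _) = false); last by apply/eqP; lia.
by rewrite !sa //; apply: rest; lia.
Qed.

Lemma table_row i f : i != u.+1 -> f < W ->
  i * W + f < u.+1 * W \/ u.+1 * W + W <= i * W + f.
Proof.
move=> iu fW; case: (ltngtP i u.+1) iu => // [lt|gt] _; [left|right].
  apply: (@leq_trans (i.+1 * W)); first by rewrite mulSnr ltn_add2l.
  by rewrite leq_mul2r lt orbT.
rewrite -mulSnr; apply: leq_trans (leq_addr _ _).
by rewrite leq_mul2r gt orbT.
Qed.

Lemma table_col j b : j <= K -> b <= n * K -> j * B1 + b < W.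
Proof.
move=> jK bB; apply: (@leq_trans (j.+1 * B1)); first by rewrite mulSnr ltn_add2l.
by rewrite leq_mul2r ltnS jK orbT.
Qed.

(** The rows [cu] and [cp] being read differ from the row [u.+1] being written, so partial progress
    leaves the data of the recurrence intact. *)
Lemma fill_ready_same xs ys s s' f :
  cu != u.+1 -> cp != u.+1 -> f <= W -> fill_progress s f s' ->
  same xs ys s s' ->
  all (fun x => x \notin xs) [:: 0; 2; 5; 6; 15; 22; 23; 24] ->
  all (fun a => a \notin ys) [:: 4; 11; 12] -> fill_ready s -> fill_ready s'.
Proof.
move=> cu_u cp_u fW [_ rest] ss xsN ysN [tab [r15 r22 r23 r24] Tu Tp].
have keep i f' : i != u.+1 -> f' < W -> arr s' 8 (i * W + f') = arr s 8 (i * W + f').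
  by move=> iu f'W; apply: (proj1 (rest _ _)); case: (table_row iu f'W); lia.
split.
- apply: tables_same ss _ ysN tab.
  by move: xsN => /= /and5P[-> -> -> -> _].
- by case: ss => sr _; move: xsN => /= /and5P[_ _ _ _ /and5P[*]]; split; rewrite sr.
- by move=> k kK; rewrite keep ?Tu // table_col.
- by move=> j b jK bB; rewrite keep ?Tp // table_col.
Qed.

Lemma ok_fill s :
  cu != u.+1 -> cp != u.+1 -> fill_ready s ->
  ok fill s (K.+2 * (B1.+1 * (cell_time + 8) + 10)) (fill_progress s W).
Proof.
move=> cu_u cp_u ready; have [[[r0 r2 r5 r6] _ _ _] _ _ _] := ready.
apply: ok_weaken (ok_for (N := K.+1) (t := B1.+1 * (cell_time + 8))
  (I := fun j => fill_progress s (j * B1)) _ _ _ _ _) _ (fun _ => id) => //.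
- by move=> s' [sr _] /=; rewrite sr // r2 addn1.
- move=> j s1 jK r16 ss1 pr1.
  have ready1 : fill_ready s1.
    apply: (fill_ready_same cu_u cp_u _ pr1 ss1 _ _ ready) => //.
    by rewrite leq_mul2r ltnW // orbT.
  have H : ok (For 17 (Reg 6) fill_cell) s1 (B1.+1 * (cell_time + 8)) (fill_progress s (j.+1 * B1)).
    apply: ok_weaken (ok_for (N := B1) (t := cell_time)
      (I := fun b => fill_progress s (j * B1 + b)) _ _ _ _ _) _ (fun _ => id) => //.
    + by move=> s' [sr _] /=; rewrite sr // (proj1 ss1).
    + by rewrite addn0.
    + move=> b s2 bB r17 ss2 pr2; rewrite addnS.
      have ready2 : fill_ready s2.
        apply: (fill_ready_same (xs := wreg fill) (ys := warr fill) cu_u cp_u _ pr2 _ _ _ ready) => //.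
          by rewrite ltnW // table_col.
        exact: same_trans (same_widen _ _ ss1) (same_widen _ _ ss2).
      apply: ok_weaken (ok_fill_cell ready2 _ r17 _ _ pr2) (leqnn _) _ => //.
      by rewrite (proj1 ss2).
    + by move=> s' _ _; rewrite mulSnr.
    + by rewrite /=; lia.
  exact: H.
- by rewrite /=; lia.
Qed.

End Fill.

(* Capping c v at nK does not change the feasible multiplicities. *)
Definition capacity (e : expr) : expr := Sub (Get 0 e) (Sub (Get 0 e) (Reg 5)).

(** Round m takes entry n - 1 - m of the search order: children come before their parents, and the
    root, entry 0, is never reached. *)
Definition prepare : cmd :=
  Seq (Assign 13 (Get 5 (Sub (Sub (Reg 0) (Lit 1)) (Reg 12))))
 (Seq (Assign 14 (Get 6 (Reg 13)))
 (Seq (Assign 15 (capacity (Reg 13)))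
 (Seq (Assign 22 (Get 11 (Get 10 (Reg 13))))
 (Seq (Assign 23 (Get 11 (Get 10 (Reg 14))))
      (Assign 24 (Get 11 (Add (Reg 13) (Lit 1)))))))).

Definition optimize : cmd :=
  For 12 (Sub (Reg 0) (Lit 1))
    (Seq prepare (Seq fill (Put 10 (Reg 14) (Add (Reg 13) (Lit 1))))).

Definition trace_init : cmd :=
  Seq (Put 13 (Reg 1) (Reg 2)) (Put 14 (Reg 1) (capacity (Reg 1))).

Definition trace_step : cmd :=
  Seq (Assign 13 (Get 5 (Add (Reg 12) (Lit 1))))
 (Seq (Assign 14 (Get 6 (Reg 13)))
 (Seq (Assign 15 (Get 9 (Add (Get 11 (Add (Reg 13) (Lit 1)))
                             (Add (Get 12 (Get 13 (Reg 14))) (Get 14 (Reg 14))))))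
 (Seq (Put 13 (Reg 13) (Reg 15))
 (Seq (Put 14 (Reg 14) (Sub (Get 14 (Reg 14)) (Reg 15)))
      (Put 14 (Reg 13) (capacity (Reg 13))))))).

Definition trace : cmd :=
  Seq trace_init (For 12 (Sub (Reg 0) (Lit 1)) trace_step).

(** * Correctness of the table and of the traceback *)

Section Solve.
Variables (n K r : nat) (par c : nat -> nat) (l : seq nat).
Hypotheses (n_gt0 : 0 < n) (size_l : size l = n.-1) (uniq_l : uniq (r :: l)).
Hypotheses (lt_l : forall v, v \in r :: l -> v < n).
Hypotheses (pf : parents_first par r l).

Let cap v := minn (c v) (n * K).
Let B1 := (n * K).+1.
Let W := K.+1 * B1.

Lemma capacity_le v : cap v <= n * K.
Proof. exact: geq_minr. Qed.

Lemma par_mem u : u \in l -> par u \in r :: l.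
Proof.
move=> ul; have [l1 [l2 el]] : exists l1 l2, l = l1 ++ u :: l2.
  by case/splitPr: ul => a b; exists a, b.
by have := pf el; rewrite el !inE mem_cat => /orP[->|->]; rewrite ?orbT.
Qed.

Definition searched (s : state) : Prop :=
  [/\ tables n K s, reg s 1 = r, arr s 0 = c, arr s 6 = par &
      forall i, i < n.-1 -> arr s 5 i.+1 = nth 0 l i].

Lemma searched_same xs ys s s' :
  same xs ys s s' -> all (fun x => x \notin xs) [:: 0; 1; 2; 5; 6] ->
  all (fun a => a \notin ys) [:: 0; 4; 5; 6; 11; 12] -> searched s -> searched s'.
Proof.
move=> ss /= /and5P[x0 x1 x2 x5 /andP[x6 _]] /and5P[a0 a4 a5 a6 /and3P[a11 a12 _]].
move=> [tab r1 s0 s6 s5]; split; last by move=> i /s5; rewrite (proj2 ss).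
- by apply: tables_same ss _ _ tab; rewrite /= ?x0 ?x2 ?x5 ?x6 ?a4 ?a11 ?a12.
- by rewrite (proj1 ss).
- by rewrite (proj2 ss).
- by rewrite (proj2 ss).
Qed.

(** By the first clause, row [u.+1] is current for no vertex while [u] is unprocessed, so [fill]
    never reads the row it writes. The last clause retains the choices of all processed vertices for
    the traceback. *)
Definition optimized (m : nat) (s : state) : Prop :=
  [/\ forall v, v < n ->
        arr s 10 v = 0 \/ exists2 w, w \in drop (n.-1 - m) l & arr s 10 v = w.+1,
      forall v j b, v < n -> j <= K -> b <= n * K ->
        arr s 8 (arr s 10 v * W + (j * B1 + b)) = opt par cap (drop (n.-1 - m) l) v j b &
      forall a j b, n.-1 - m <= a < n.-1 -> j <= K -> b <= n * K ->
        best_choice par cap (drop a.+1 l) (nth 0 l a) j b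
          (arr s 9 ((nth 0 l a).+1 * W + (j * B1 + b)))].

Definition fill_time := K.+2 * (B1.+1 * (cell_time K + 8) + 10).

Lemma ok_optimize_step m s :
  m < n.-1 -> reg s 12 = m -> searched s -> optimized m s ->
  ok (Seq prepare (Seq fill (Put 10 (Reg 14) (Add (Reg 13) (Lit 1))))) s
     (time prepare + (fill_time + 5)) (optimized m.+1).
Proof.
move=> mN r12 srch [cur row cho].
have [[[r0 r2 r5 r6] _ t12 t11] r1 a0 a6 a5] := srch.
set a := n.-1 - m.+1; have aN : a < n.-1 by rewrite /a; lia.
have am : n.-1 - m = a.+1 by rewrite /a; lia.
rewrite am in cur row cho.
have dropE : drop a l = nth 0 l a :: drop a.+1 l by rewrite -drop_nth ?size_l.
set u := nth 0 l a in dropE; have ul : u \in l by rewrite mem_nth ?size_l.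
have uN : u \notin drop a.+1 l.
  have : uniq (drop a l) by apply: drop_uniq; case/andP: uniq_l.
  by rewrite dropE => /andP[].
have un : u < n by apply: lt_l; rewrite inE ul orbT.
have pn : par u < n by apply/lt_l/par_mem.
have cur_n v : v < n -> arr s 10 v <= n.
  move=> /cur[->//|[w wl ->]]; apply: lt_l.
  by rewrite inE (mem_drop wl) orbT.
have cur_u v : v < n -> arr s 10 v != u.+1.
  move=> /cur[->//|[w wl ->]]; rewrite eqSS.
  by apply: contraNneq uN => <-.
apply: ok_seq; apply: ok_run => //; set s1 := run _ s.
have ss1 : same (wreg prepare) (warr prepare) s s1.
  by split=> // z; rewrite !inE !negb_or /= => /and5P[/negPf-> /negPf-> /negPf-> /negPf-> /andP[/negPf-> /negPf->]].
have r13 : reg s1 13 = u.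
  by rewrite /= r0 r12 (_ : n - 1 - m = a.+1) ?a5 // /a; lia.
have r14 : reg s1 14 = par u by rewrite -r13 /= a6.
have ready : fill_ready n K par cap (drop a.+1 l) u (arr s 10 u) (arr s 10 (par u)) s1.
  split.
  - by apply: (tables_same ss1); case: srch.
  - split.
    + by transitivity (c u - (c u - n * K)); [rewrite -r13 /= a0 r5 | rewrite /cap; lia].
    + by rewrite -t11 ?cur_n // -r13.
    + by rewrite -t11 ?cur_n // -r14.
    + by rewrite -t11 // -[u]r13 /= addn1.
  - by move=> k kK; rewrite row ?capacity_le.
  - by move=> j b jK bB; rewrite row.
have H := ok_same (ok_fill capacity_le (cur_u _ un) (cur_u _ pn) ready).
apply: ok_seq; apply: ok_weaken H (leqnn _) _ => s2 [[sr sa] [done rest]].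
apply: ok_run => //.
have keep i f : i != u.+1 -> f < W ->
    arr s2 8 (i * W + f) = arr s 8 (i * W + f) /\ arr s2 9 (i * W + f) = arr s 9 (i * W + f).
  by move=> iu fW; apply: rest; case: (table_row iu fW); lia.
have r13' : reg s2 13 = u by rewrite sr.
have r14' : reg s2 14 = par u by rewrite sr.
have a10 : arr s2 10 = arr s 10 by rewrite sa.
have filledE j b : j <= K -> b <= n * K ->
    filled n K par cap (drop a.+1 l) u s2 (j * B1 + b) ->
    arr s2 8 (u.+1 * W + (j * B1 + b)) = opt par cap (drop a l) (par u) j b /\
    best_choice par cap (drop a.+1 l) u j b (arr s2 9 (u.+1 * W + (j * B1 + b))).
  by move=> jK bB; rewrite /filled divnMDl // modnMDl divn_small // modn_small // addn0 dropE.
split; rewrite -/a /= ?r13' ?r14' ?a10 ?addn1.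
- move=> v vn; case: eqP => _; first by right; exists u; rewrite ?dropE ?inE ?eqxx.
  by case: (cur v vn) => [|[w wl ->]]; [left | right; exists w; rewrite // dropE inE wl orbT].
(* The parent of [u] now refers to the row just filled; for any other vertex [opt] skips the new
   head [u], so its old row stays correct. *)
- move=> v j b vn jK bB; have lt_f := table_col jK bB.
  have [->|/eqP vp] := eqP; first by apply: (proj1 (filledE _ _ jK bB (done _ lt_f))).
  by rewrite (proj1 (keep _ _ (cur_u v vn) lt_f)) row // dropE /opt -/opt (negPf vp).
- move=> a' j b /andP[le_a a'N] jK bB; have lt_f := table_col jK bB.
  have [<-|ne] := eqVneq a a'; first by apply: (proj2 (filledE _ _ jK bB (done _ lt_f))).
  have lt_a : a < a' by rewrite ltn_neqAle ne.
  rewrite (proj2 (keep _ _ _ lt_f)); first by apply: cho; rewrite ?lt_a.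
  rewrite eqSS /u nth_uniq ?size_l ?(leq_trans lt_a (ltnW a'N)) //.
    by rewrite eq_sym.
  by case/andP: uniq_l.
Qed.

Lemma ok_optimize s :
  searched s -> (forall v, arr s 8 v = 0) -> (forall v, arr s 10 v = 0) ->
  ok optimize s (n * (time prepare + fill_time + 15)) (optimized n.-1).
Proof.
move=> srch T0 cur0; have [[[r0 _ _ _] _ _ _] _ _ _ _] := srch.
apply: ok_weaken (ok_for (N := n.-1) (t := time prepare + (fill_time + 5)) (I := optimized) _ _ _ _ _) _ (fun _ => id) => //.
- by move=> s' [sr _] /=; rewrite sr // r0 subn1.
(* Before the first round all vertices refer to the zero row, which is [opt] on the empty suffix. *)
- split=> [v vn|v j b vn jK bB|a j b]; [by left; exact: cur0 | | by lia].
  by rewrite /= T0 subn0 drop_oversize // size_l.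
- move=> m s' mN r12 ss opt_m.
  apply: ok_weaken (ok_optimize_step mN r12 (searched_same ss _ _ srch) opt_m) (leqnn _) _ => //.
- by rewrite /= prednK // leq_mul2l; lia.
Qed.

Lemma ok_trace s :
  searched s -> optimized n.-1 s ->
  ok trace s (time trace_init + n * (time trace_step + 10))
     (fun s' => traced par cap r K l l [::] (arr s' 13) (arr s' 14)).
Proof.
move=> srch [_ _ cho]; have [[[r0 r2 r5 _] _ _ _] r1 a0 _ _] := srch.
apply: ok_seq; apply: ok_run => //; set s1 := run _ s.
have capE v : c v - (c v - n * K) = cap v by rewrite /cap; lia.
have ss1 : same [::] [:: 13; 14] s s1.
  by split=> // z; rewrite !inE !negb_or /= => /andP[/negPf-> /negPf->].
pose I m s' := traced par cap r K l (take m l) (drop m l) (arr s' 13) (arr s' 14).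
apply: ok_weaken (ok_for (N := n.-1) (t := time trace_step) (I := I) _ _ _ _ _) _ (fun _ => id) => //.
- by move=> s' [sr _] /=; rewrite sr // r0 subn1.
- rewrite /I take0 drop0; apply: traced_init => /=; first by rewrite r1 eqxx.
  by rewrite r1 eqxx a0 r5 capE.
- move=> m s2 mN r12 ss tr.
  have ss2 : same (12 :: wreg trace_step) (warr trace_step) s s2.
    exact: same_trans (same_widen _ _ ss1) ss.
  have srch2 : searched s2 by apply: searched_same ss2 _ _ srch.
  have [[[r0' r2' r5' _] _ t12 t11] _ a0' a6 a5] := srch2.
  have a9 : arr s2 9 = arr s 9 by rewrite (proj2 ss2).
  apply: ok_run => //; set u := nth 0 l m.
  have dropE : drop m l = u :: drop m.+1 l by rewrite -drop_nth ?size_l.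
  have ul : u \in l by rewrite mem_nth ?size_l.
  have un : u < n by apply: lt_l; rewrite inE ul orbT.
  have ell : l = take m l ++ u :: drop m.+1 l by rewrite -dropE cat_take_drop.
  have pl := pf ell.
  rewrite /I (take_nth 0) ?size_l // -/u; rewrite /I dropE in tr.
  have [_ xK remE _ _] := tr.
  (* Capping the capacities at nK keeps the column index inside the row. *)
  have remB : arr s2 14 (par u) <= n * K.
    by apply: leq_trans (capacity_le (par u)); rewrite -remE // leq_addr.
  have := cho m _ _ _ (xK _ pl) remB; rewrite subnn mN => /(_ isT) bc.
  have := traced_rcons uniq_l pf ell bc tr.
  rewrite /= r12 addn1 a5 // -/u a6 a0' r5' capE a9 addn1 t11 // t12 ?xK //.
- by move=> s' _ _; rewrite /I take_oversize ?drop_oversize ?size_l.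
- by rewrite /= prednK // leq_mul2l; lia.
Qed.

End Solve.

(** * Writing out the trees *)

Definition write_vertex : cmd :=
  Seq (Put 2 (Reg 19) (Sub (Lit 1) (Sub (Add (Reg 16) (Lit 1)) (Get 13 (Reg 17)))))
      (Assign 19 (Add (Reg 19) (Lit 1))).

(** In truncated arithmetic k + 1 - x u vanishes exactly when k < x u, so the adjacency bit survives
    only if both deficits are 0. Registers 19 and 20 are running positions, which avoids computing
    products. *)
Definition write_edge : cmd :=
  Seq (Put 3 (Reg 20)
         (Sub (Get 1 (Add (Get 4 (Reg 17)) (Reg 18)))
              (Add (Sub (Add (Reg 16) (Lit 1)) (Get 13 (Reg 17)))
                   (Sub (Add (Reg 16) (Lit 1)) (Get 13 (Reg 18))))))
      (Assign 20 (Add (Reg 20) (Lit 1))).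

Definition output_row : cmd := Seq write_vertex (For 18 (Reg 0) write_edge).

Definition output : cmd :=
  Seq (Seq (Assign 19 (Lit 0)) (Assign 20 (Lit 0)))
      (For 16 (Reg 2) (For 17 (Reg 0) output_row)).

Section Output.
Variables (n K : nat) (A : nat -> nat -> bool) (x : nat -> nat).

Definition vertex_bit (q : nat) : bool := q %/ n < x (q %% n).

Definition edge_bit (q : nat) : bool :=
  let k := q %/ n %/ n in let u := q %/ n %% n in let v := q %% n in
  [&& A u v, k < x u & k < x v].

Definition output_ready (s : state) : Prop :=
  [/\ tables n K s, adjacency n A s & arr s 13 = x].

Lemma output_ready_same xs ys s s' :
  same xs ys s s' -> all (fun z => z \notin xs) [:: 0; 2; 5; 6] ->
  all (fun a => a \notin ys) [:: 1; 4; 11; 12; 13] ->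
  output_ready s -> output_ready s'.
Proof.
move=> ss xsN /= /and5P[a1 a4 a11 a12 /andP[a13 _]] [tab adj ax]; split.
- by apply: tables_same ss xsN _ tab; rewrite /= a4 a11 a12.
- by move=> u v un vn; rewrite (proj2 ss) ?adj.
- by rewrite (proj2 ss).
Qed.

Definition written (p e : nat) (s : state) : Prop :=
  [/\ reg s 19 = p, reg s 20 = e,
      forall q, q < p -> arr s 2 q = vertex_bit q &
      forall q, q < e -> arr s 3 q = edge_bit q].

Definition output_row_time := time write_vertex + n.+1 * (time write_edge + 8).

Lemma ok_output_row s k u :
  output_ready s -> reg s 16 = k -> reg s 17 = u -> u < n ->
  written (k * n + u) ((k * n + u) * n) s ->
  ok output_row s output_row_time (written (k * n + u).+1 ((k * n + u).+1 * n)).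
Proof.
move=> ready rk ru un [r19 r20 w2 w3]; have [tab adj ax] := ready.
apply: ok_seq; apply: ok_run => //; set s1 := run _ s.
have ss1 : same [:: 19] [:: 2] s s1.
  by split=> // z; rewrite !inE /= => /negPf->.
apply: ok_weaken (ok_for (N := n) (t := time write_edge)
  (I := fun v => written (k * n + u).+1 ((k * n + u) * n + v)) _ _ _ _ _) _ (fun _ => id) => //.
- by move=> s' [sr _] /=; rewrite sr //=; case: tab => -[].
- split=> //=; rewrite ?r19 ?addn1 ?addn0 // => q.
  rewrite ltnS leq_eqVlt ru rk ax => /orP[/eqP->|lt_q].
    rewrite eqxx /vertex_bit divnMDl 1?(leq_trans _ un) // modnMDl.
    by rewrite divn_small // modn_small // addn0; lia.
  by rewrite (ltn_eqF lt_q) w2.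
- move=> v s2 vn rv ss [r19' r20' w2' w3'].
  have ss2 : same (18 :: 19 :: wreg write_edge) (2 :: warr write_edge) s s2.
    exact: same_trans (same_widen _ _ ss1) (same_widen _ _ ss).
  have [[_ t4 _ _] adj' ax'] : output_ready s2 by apply: output_ready_same ss2 _ _ ready.
  have rk' : reg s2 16 = k by rewrite (proj1 ss2).
  have ru' : reg s2 17 = u by rewrite (proj1 ss2).
  apply: ok_run => //; split=> //=; rewrite ?r20' ?addn1 ?addnS // => q.
  rewrite ltnS leq_eqVlt => /orP[/eqP->|lt_q]; last by rewrite (ltn_eqF lt_q) w3'.
  rewrite eqxx rk' ru' rv t4 // adj' // ax' /edge_bit.
  have n0 : 0 < n by apply: leq_trans un.
  rewrite !divnMDl // !modnMDl !(divn_small vn) !(modn_small vn) !addn0.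
  rewrite divnMDl // modnMDl (divn_small un) (modn_small un) addn0.
  by case: (A u v) => //=; lia.
- by move=> s' _ _; rewrite mulSnr.
Qed.

Lemma ok_output s :
  output_ready s ->
  ok output s (4 + K.+1 * (n.+1 * (output_row_time + 8) + 8))
     (written (K * n) (K * n * n)).
Proof.
move=> ready; have [[[r0 r2 _ _] _ _ _] _ _] := ready.
apply: ok_seq; apply: ok_run => //; set s1 := run _ s.
have ss1 : same [:: 19; 20] [::] s s1.
  by split=> // z; rewrite !inE negb_or /= => /andP[/negPf-> /negPf->].
apply: ok_weaken (ok_for (N := K) (t := n.+1 * (output_row_time + 8))
  (I := fun k => written (k * n) (k * n * n)) _ _ _ _ _) _ (fun _ => id) => //.
- by move=> s' [sr _] /=; rewrite sr.
- move=> k s2 kK rk ss2 w.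
  have H : ok (For 17 (Reg 0) output_row) s2 (n.+1 * (output_row_time + 8))
              (written (k.+1 * n) (k.+1 * n * n)); last exact: H.
  apply: ok_weaken (ok_for (N := n) (t := output_row_time)
    (I := fun u => written (k * n + u) ((k * n + u) * n)) _ _ _ _ _) _ (fun _ => id) => //.
  + by move=> s' [sr _] /=; rewrite sr // (proj1 ss2).
  + by rewrite !addn0.
  + move=> u s3 un ru ss3 w3.
    have ss : same (wreg output) (warr output) s s3.
      exact: same_trans (same_trans (same_widen _ _ ss1) (same_widen _ _ ss2)) (same_widen _ _ ss3).
    have ready3 : output_ready s3 by apply: output_ready_same ss _ _ ready.
    rewrite addnS; apply: ok_weaken (ok_output_row ready3 _ ru un w3) (leqnn _) _ => //.
    by rewrite (proj1 ss3).
  + by move=> s' _ _; rewrite mulSnr.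
  + by rewrite /=; lia.
- by rewrite /=; lia.
Qed.

End Output.

(** * Packings as vertex multiplicities *)

Section Multiplicities.
Variables (V : finType) (G : sgraph V) (r : V) (par : V -> V) (rk : V -> nat).
Hypotheses (vertsG : verts G = [set: V]) (treeG : is_tree G).
Hypothesis rk_par : forall v, v != r -> rk (par v) < rk v.
Hypothesis edge_par : forall v, v != r -> edge G (par v) v.

Lemma par_ind (P : V -> Prop) :
  P r -> (forall v, v != r -> P (par v) -> P v) -> forall v, P v.
Proof.
move=> Pr Pstep v; have [m] := ubnP (rk v); elim: m v => // m IHm v lt_m.
have [->//|vr] := eqVneq v r.
apply: Pstep => //; apply: IHm; have := rk_par vr; lia.
Qed.

(* Otherwise the path of parent edges from u to v and the edge uv form a cycle. *)
Lemma edge_is_par u v :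
  edge G u v -> (v != r) && (par v == u) || (u != r) && (par u == v).
Proof.
move=> uv; pose e := [rel a b | (b != r) && (par b == a) || (a != r) && (par a == b)].
have esym : symmetric e by move=> a b; rewrite /= orbC.
have eG : subrel e (edge G).
  move=> a b /orP[]/andP[ne /eqP<-]; first exact: edge_par.
  by rewrite (edge_sym G) edge_par.
have toroot a : connect e r a.
  elim/par_ind: a => // a ar IH; apply: connect_trans IH (connect1 _).
  by rewrite /= ar eqxx.
have /connectP[p ep lp] : connect e u v.
  by apply: (connect_trans _ (toroot v)); rewrite (sym_connect_sym esym) toroot.
move: lp; case/shortenP: ep => q eq uq _ {p} lp.
(* A path without edges would make [uv] a loop, a single edge is the claim itself, and two or more
   edges close up with [uv] to a cycle on at least three vertices. *)
case: q eq uq lp => [|a [|b q]] eq uq lp.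
- by move: uv; rewrite lp /= (edge_irr G).
- by move: eq; rewrite /= andbT in lp *; rewrite lp.
have: size (u :: a :: b :: q) <= 2; last by [].
apply: (proj2 treeG); rewrite /ucycle uq andbT.
change (path (edge G) u (rcons [:: a, b & q] u)).
have -> := rcons_path (edge G) u [:: a, b & q] u.
rewrite (sub_path eG eq) -lp.
by rewrite (edge_sym G).
Qed.

(** A simple path from [r] only descends: its first edge leads to a child of [r], and a later step
    upwards would return to the preceding vertex. *)
Lemma last_par p u :
  path (edge G) r (rcons p u) -> uniq (r :: rcons p u) ->
  u != r /\ par u = last r p.
Proof.
elim/last_ind: p u => [|p w IHp] u.
  by rewrite /= andbT => /edge_is_par; rewrite eqxx orbF => /andP[ur /eqP].
rewrite rcons_path last_rcons -rcons_cons rcons_uniq => /andP[pw /edge_is_par wu].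
move=> /andP[uN uq]; have [wr parw] := IHp w pw uq.
case/orP: wu => /andP[ne /eqP] // eu; case/negP: uN.
by rewrite -eu parw -cats1 -cat_cons mem_cat mem_last.
Qed.

(** Simple paths of [T] are simple paths of [G], so the vertex before [u] is its parent in [G]; such
    a path exists by connectedness of [T]. Hence the children in [T] depend only on [verts T]. *)
Lemma is_child_par T v u :
  rooted_tree G r T ->
  is_child r T v u = [&& u \in verts T, u != r & par u == v].
Proof.
move=> [[_ sTG] [[_ cT] _] rT]; apply/existsP/and3P.
  case=> p /and3P[pth uq /eqP lp].
  have [ur pu] := last_par (sub_path (sTG : subrel _ _) pth) uq.
  split=> //; last by rewrite pu lp.
  move: pth; rewrite rcons_path => /andP[_].
  by rewrite (edge_sym T) => /edge_verts.
case=> uT ur /eqP <-; case/connectP: (cT _ _ rT uT) => p0 pth0 lp0.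
move: lp0; case/shortenP: pth0 => p pth uq _ {p0}.
case/lastP: p pth uq => [|p w] pth uq /=; first by move=> eu; rewrite eu eqxx in ur.
rewrite last_rcons => uw; rewrite -{}uw in pth uq *.
have [_ pu] := last_par (sub_path (sTG : subrel _ _) pth) uq.
have szp : size p <= #|V|.
  have /card_uniqP cp := uq.
  by have := max_card (mem (r :: rcons p u)); rewrite cp /= size_rcons; lia.
by exists (Bseq szp); rewrite pth pu eqxx andbT.
Qed.

Lemma par_verts T u :
  rooted_tree G r T -> u \in verts T -> u != r -> par u \in verts T.
Proof.
move=> rtT uT ur; have : is_child r T (par u) u by rewrite is_child_par // uT ur /=.
by case/existsP=> p /and3P[]; rewrite rcons_path => /andP[_ /edge_verts H] _ /eqP <-.
Qed.

Definition feasible (c : V -> nat) (K : nat) (x : V -> nat) : Prop :=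
  [/\ x r = K, forall u, x u <= K, forall u, u != r -> x u <= x (par u) &
      forall v, \sum_(u | (u != r) && (par u == v)) x u <= c v].

Section Level.
Variables (x : V -> nat) (k : nat).

Definition level_edge : rel V := [rel u v | [&& edge G u v, k < x u & k < x v]].

Lemma level_sym : symmetric level_edge.
Proof. by move=> u v; rewrite /level_edge /= [in LHS]edge_sym [(_ < x u) && _]andbC. Qed.

Lemma level_irr : irreflexive level_edge.
Proof. by move=> u; rewrite /level_edge /= edge_irr. Qed.

Lemma level_verts u v : level_edge u v -> u \in [set w | k < x w].
Proof. by rewrite inE => /and3P[]. Qed.

Definition level : sgraph V := SGraph level_sym level_irr level_verts.

(** Monotonicity of [x] closes the level set under parents, so each of its vertices is joined to [r]
    inside it; acyclicity is inherited from [G]. *)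
Lemma level_rooted_tree :
  k < x r -> (forall u, u != r -> x u <= x (par u)) -> rooted_tree G r level.
Proof.
move=> kr mono; have sub : subrel level_edge (edge G) by move=> u v /and3P[].
split; [split | split; first split | by rewrite inE].
- by rewrite vertsG subsetT.
- exact: sub.
- by apply/set0Pn; exists r; rewrite inE.
- have toroot u : k < x u -> connect level_edge r u.
    elim/par_ind: u => // u ur IH ku.
    have kp := leq_trans ku (mono u ur).
    apply: connect_trans (IH kp) (connect1 _).
    by rewrite /level_edge /= edge_par // kp.
  move=> u v; rewrite !inE => ku kv; apply: (connect_trans _ (toroot v kv)).
  by rewrite (sym_connect_sym level_sym) toroot.
- move=> s /andP[cyc uq]; apply: (proj2 treeG); rewrite /ucycle uq andbT.
  by move: cyc; case: s {uq} => //= a s; apply: sub_path sub _ _.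
Qed.

End Level.

(** Double counting of the pairs of a tree and a child of [v] in it. *)
Lemma sum_children (K : nat) (T : 'I_K -> sgraph V) v :
  (forall k, rooted_tree G r (T k)) ->
  \sum_(k < K) children r (T k) v =
    \sum_(u | (u != r) && (par u == v)) #|[set k | u \in verts (T k)]|.
Proof.
move=> rtT.
transitivity (\sum_(k < K) \sum_(u | (u != r) && (par u == v)) (u \in verts (T k))).
  apply: eq_bigr => k _; rewrite /children -sum1dep_card.
  rewrite [RHS]big_mkcond [LHS]big_mkcond /=; apply: eq_bigr => u _.
  by rewrite is_child_par //; case: (u \in _) => //=; case: ifP.
rewrite exchange_big; apply: eq_bigr => u _.
by rewrite -sum1dep_card [RHS]big_mkcond; apply: eq_bigr => k _; case: (_ \in _).
Qed.

Lemma packing_size_sum (K : nat) (T : 'I_K -> sgraph V) :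
  packing_size T = \sum_u #|[set k | u \in verts (T k)]|.
Proof.
transitivity (\sum_(k < K) \sum_u (u \in verts (T k))).
  by apply: eq_bigr => k _; rewrite -sum1_card big_mkcond; apply: eq_bigr => u _; case: (_ \in _).
rewrite exchange_big; apply: eq_bigr => u _.
by rewrite -sum1dep_card [RHS]big_mkcond; apply: eq_bigr => k _; case: (_ \in _).
Qed.

Lemma card_ord_lt K m : m <= K -> #|[set k : 'I_K | k < m]| = m.
Proof.
move=> leK; rewrite -sum1dep_card -(big_ord_widen K (fun=> 1) leK).
by rewrite sum1_card card_ord.
Qed.

(** Exactly [x u] level trees contain [u], and the multiplicities of any packing are feasible with
    total equal to its size, so maximality carries over. *)
Lemma feasible_max_packing (c : V -> nat) (K : nat) (x : V -> nat) :
  feasible c K x ->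
  (forall y, feasible c K y -> \sum_u y u <= \sum_u x u) ->
  max_packing G r c (fun k : 'I_K => level x k).
Proof.
move=> [xr xK mono xc] xmax.
have mult u : #|[set k : 'I_K | u \in verts (level x k)]| = x u.
  by rewrite -[RHS](card_ord_lt (xK u)); apply: eq_card => k; rewrite !inE.
have rtl (k : 'I_K) : rooted_tree G r (level x k).
  by apply: level_rooted_tree; rewrite // xr.
split; first split=> // v.
  by rewrite sum_children //; under eq_bigr do rewrite mult.
move=> T [rtT Tc]; rewrite !packing_size_sum; under [leqRHS]eq_bigr do rewrite mult.
apply: xmax; split=> [|u|u ur|v].
- rewrite -[RHS]card_ord; apply: eq_card => k; rewrite !inE.
  by case: (rtT k).
- by rewrite -[leqRHS]card_ord max_card.
- apply: subset_leq_card; apply/subsetP=> k; rewrite !inE => uk.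
  exact: par_verts.
- by rewrite -sum_children.
Qed.

End Multiplicities.

(** The first queue entry is [r]; the list [l] is the rest of the queue, whence the index shift by
    one. *)
Lemma grown_order n r A o p vis (l := mkseq (fun i => o i.+1) n.-1) :
  grown n r A o p vis n ->
  [/\ uniq (r :: l), forall v, v \in r :: l -> v < n, parents_first p r l &
      forall u, u \in l -> A (p u) u].
Proof.
move=> [[n0 o0 uq] on _ par].
have lE : mkseq o n = r :: l.
  by rewrite /l /mkseq -{1}(prednK n0) /= o0 -[1]addn0 iotaDl -map_comp.
split.
- by rewrite -lE.
- by move=> v; rewrite -lE => /mapP[a]; rewrite mem_iota add0n => /andP[_ an] ->; exact: on.
- move=> l1 u l2 el; have szl : size l1 < n.-1.
    by rewrite -(size_mkseq (fun i => o i.+1) n.-1) -/l el size_cat /= addnS ltnS leq_addr.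
  have uE : u = o (size l1).+1.
    by rewrite -(nth_mkseq 0 (fun i => o i.+1) szl) -/l el nth_cat ltnn subnn.
  have [|b [lt_b pb _]] := par (size l1).+1; first by lia.
  rewrite uE pb -(nth_mkseq 0 o (_ : b < n)); last by lia.
  by rewrite lE el -cat_cons nth_cat /= lt_b mem_nth.
- move=> u /mapP[a]; rewrite mem_iota add0n => /andP[_ an] ->.
  by have [|b [_ -> //]] := par a.+1; lia.
Qed.

(** * Optimality of the traced multiplicities on the given tree *)

Section Assembly.
Variables (n : nat) (G : sgraph 'I_n) (r : 'I_n).

Definition adj (u v : nat) : bool :=
  if insub u is Some u' then
    if insub v is Some v' then edge G u' v' else false
  else false.

Lemma adj_ord (u v : 'I_n) : adj u v = edge G u v.
Proof. by rewrite /adj !valK. Qed.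

Lemma tab_ord (f : 'I_n -> nat) (u : 'I_n) : tab f u = f u.
Proof. by rewrite /tab valK. Qed.

Hypotheses (vertsG : verts G = [set: 'I_n]) (treeG : is_tree G).

Lemma reachable_adj : reachable_all n r adj.
Proof.
move=> S Sr Sedge v vn; set w := Ordinal vn.
have /connectP[q] : connect (edge G) r w by apply: (proj2 (proj1 treeG)); rewrite vertsG inE.
suff : forall u : 'I_n, S u -> path (edge G) u q -> S (last u q).
  by move=> + pth ew; rewrite -[v]/(val w) ew; apply.
elim: q => //= a q IH u Su /andP[ua /IH]; apply.
by apply: (Sedge u) => //; rewrite adj_ord.
Qed.

Section Optimality.
Variables (K : nat) (c : 'I_n -> nat) (par x rem : nat -> nat) (l : seq nat).
Hypotheses (size_l : size l = n.-1) (uniq_l : uniq (val r :: l)).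
Hypothesis lt_l : forall v, v \in val r :: l -> v < n.
Hypothesis pf : parents_first par r l.
Hypothesis edge_l : forall u, u \in l -> adj (par u) u.

Let cap v := minn (tab c v) (n * K).

Hypothesis tr : traced par cap r K l l [::] x rem.

(** Pigeonhole: the order consists of n distinct numbers below n. *)
Lemma mem_order (v : 'I_n) : val v \in val r :: l.
Proof.
have [||_ ->] := @uniq_min_size _ (val r :: l) (iota 0 n) uniq_l.
- by move=> w /lt_l; rewrite mem_iota.
- by rewrite size_iota /= size_l; case: (n) r => [[]|].
- by rewrite mem_iota /= add0n.
Qed.

Lemma order_cases (v : 'I_n) : v != r -> val v \in l.
Proof. by move=> vr; have := mem_order v; rewrite inE (inj_eq val_inj) (negPf vr). Qed.

(** The search prescribes no parent for the root, so [par r] may be out of range; the default [r]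
    covers that case. *)
Definition parent (v : 'I_n) : 'I_n := insubd r (par v).

Lemma val_parent (v : 'I_n) : v != r -> val (parent v) = par v.
Proof.
move=> /order_cases vl; rewrite val_insubd lt_l //.
exact: par_mem pf _ vl.
Qed.

Lemma sum_order (P : pred nat) (F : nat -> nat) :
  \sum_(u < n | P u) F u = \sum_(v <- val r :: l | P v) F v.
Proof.
rewrite -(big_mkord P F) /index_iota subn0; apply: perm_big.
apply: uniq_perm => // [|v]; first exact: iota_uniq.
rewrite mem_iota add0n /=; apply/idP/idP => [vn|/lt_l//].
exact: mem_order (Ordinal vn).
Qed.

Lemma children_sum_ord (F : nat -> nat) (v : 'I_n) :
  \sum_(u < n | (u != r) && (parent u == v)) F u = children_sum par l F v.
Proof.
transitivity (\sum_(u < n | (val u != val r) && (par u == v)) F u).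
  apply: eq_bigl => u; rewrite (inj_eq val_inj); case: eqVneq => //= ur.
  by rewrite -(inj_eq val_inj) val_parent.
rewrite (sum_order (fun u => (u != val r) && (par u == v))) big_cons eqxx /=.
rewrite big_seq_cond [RHS]big_seq_cond; apply: eq_bigl => w.
case wl: (w \in l) => //=; case: eqVneq => //= wr.
by move: uniq_l; rewrite /= -wr wl.
Qed.

Lemma traced_feasible : feasible r parent c K (fun u => x u).
Proof.
have [xr xK remE mono _] := tr; split=> // [u|u ur|v].
- exact/xK/mem_order.
- by rewrite val_parent // mono // order_cases.
- rewrite children_sum_ord; have := remE v (mem_order v).
  by rewrite /cap tab_ord => remv; lia.
Qed.

(** The rank is the position in the search order. Any feasible [y] is bounded through [opt_upper],
    and [x] attains the bound by the constancy of the potential. *)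
Lemma traced_max_packing : max_packing G r c (fun k : 'I_K => level G (fun u => x u) k).
Proof.
apply: (feasible_max_packing (par := parent) (rk := fun v => index (val v) (val r :: l))) => //.
- move=> v vr; have vl := order_cases vr; rewrite val_parent //.
  have [l1 [l2 el]] : exists l1 l2, l = l1 ++ val v :: l2.
    by case/splitPr: vl => a b; exists a, b.
  have vN : val v \notin val r :: l1.
    by move: uniq_l; rewrite el -cat_rcons -cat_cons cat_uniq -rcons_cons rcons_uniq => /andP[/andP[]].
  rewrite el -cat_cons !index_cat (pf el) (negPf vN).
  by apply: leq_trans _ (leq_addr _ _); rewrite index_mem; exact: pf el.
- by move=> v vr; rewrite -adj_ord val_parent // edge_l // order_cases.
- exact: traced_feasible.
- move=> y [yr yK ymono yc].
  have [xr _ _ _ pot] := tr.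
  have yE (u : 'I_n) : tab y u = y u := tab_ord y u.
  rewrite (sum_order xpredT x) -(potential_nil par cap _ _ rem) pot.
  have -> : \sum_u y u = \sum_(v <- val r :: l) tab y v.
    by rewrite -(sum_order xpredT); apply: eq_bigr => u _; rewrite yE.
  have tabK v : tab y v <= K by rewrite /tab; case: insubP.
  have -> : K = tab y r by rewrite yE.
  apply: opt_upper => // [u ul|v vl].
    have un : u < n by apply: lt_l; rewrite inE ul orbT.
    have ur : Ordinal un != r.
      by apply: contraTneq ul => /(congr1 val) /= ->; move: uniq_l => /andP[].
    rewrite -[u]/(val (Ordinal un)) -val_parent // !yE; exact: ymono.
  rewrite leq_min; apply/andP; split.
    rewrite -[v]/(val (Ordinal (lt_l vl))) tab_ord -children_sum_ord.
    by apply: leq_trans (yc _); rewrite leq_eqVlt; apply/orP; left; apply/eqP;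
      apply: eq_bigr => u _; rewrite yE.
  (* The capped capacity is respected too: a vertex has at most n - 1 children, each of multiplicity
     at most K. *)
  apply: (@leq_trans (\sum_(w <- l) K)).
    rewrite /children_sum big_mkcond; apply: leq_sum => w _.
    by case: ifP.
  rewrite big_const_seq count_predT iter_addn_0 size_l mulnC.
  by rewrite leq_mul2r leq_pred orbT.
Qed.

End Optimality.
End Assembly.

(** * The whole program and its running time *)

Definition program : cmd :=
  Seq setup (Seq search (Seq optimize (Seq trace output))).

Definition program_time (n K : nat) : nat :=
  15 + (n + K.+1 + K.+2 + n.+2) * 17
  + (time search_init + n.+1 * (n.+1 * (time visit + 8) + 11)
  + (n * (time prepare + fill_time n K + 15)
  + (time trace_init + n * (time trace_step + 10)
  + (4 + K.+1 * (n.+1 * (output_row_time n + 8) + 8))))).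

(** Expanded, the time is a polynomial whose monomials have degree at most 2 in n and 3 in K; for
    positive n and K each is at most [n ^ 3 * K ^ 3], and 5000 bounds the sum of the
    coefficients. *)
Lemma program_time_le n K :
  0 < n -> 0 < K -> program_time n K <= 5000 * (n ^ 3 * K ^ 3).
Proof.
move=> n0 K0.
have mono i j : i <= 3 -> j <= 3 -> n ^ i * K ^ j <= n ^ 3 * K ^ 3.
  by move=> i3 j3; rewrite leq_mul ?leq_pexp2l.
have m10 := mono 1 0 isT isT; have m01 := mono 0 1 isT isT.
have m00 := mono 0 0 isT isT; have m11 := mono 1 1 isT isT.
have m20 := mono 2 0 isT isT; have m21 := mono 2 1 isT isT.
have m12 := mono 1 2 isT isT; have m22 := mono 2 2 isT isT.
have m13 := mono 1 3 isT isT; have m23 := mono 2 3 isT isT.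
rewrite /program_time /fill_time /cell_time /output_row_time /=.
move: (n ^ 3 * K ^ 3) m10 m01 m00 m11 m20 m21 m12 m22 m13 m23 {mono} => M.
rewrite !expnS !expn0 !muln1 !mul1n; nia.
Qed.

Lemma ok_program n (G : sgraph 'I_n) (r : 'I_n) (c : 'I_n -> nat) K :
  verts G = [set: 'I_n] -> is_tree G ->
  ok program (mbrtp_input G r c K) (program_time n K)
     (fun s => exists T : 'I_K -> sgraph 'I_n, mbrtp_output s T /\ max_packing G r c T).
Proof.
move=> vertsG treeG; set s0 := mbrtp_input G r c K.
have n0 : 0 < n := leq_ltn_trans (leq0n r) (ltn_ord r).
apply: ok_seq; apply: ok_weaken (ok_setup (n := n) (K := K) (s := s0) n0 erefl erefl) (leqnn _) _.
move=> s1 [ss1 tab1].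
have adj1 : adjacency n (adj G) s1.
  move=> u v un vn; rewrite (proj2 ss1) //= divnMDl // modnMDl divn_small // modn_small // addn0.
  by rewrite -[u]/(val (Ordinal un)) -[v]/(val (Ordinal vn)) !tab_ord adj_ord.
have r1 : reg s1 1 = r by rewrite (proj1 ss1).
have vis0 v : arr s1 7 v = 0 by rewrite (proj2 ss1).
have H2 := ok_same (ok_search (ltn_ord r) (reachable_adj vertsG treeG) tab1 adj1 r1 vis0).
apply: ok_seq; apply: ok_weaken H2 (leqnn _) _ => s2 [ss2 gr].
have [uql ltl pf edge_l] := grown_order gr.
set l := mkseq _ _ in uql ltl pf edge_l.
have szl : size l = n.-1 by rewrite size_mkseq.
have srch2 : searched n K r (arr s2 6) (tab c) l s2.
  split.
  - exact: tables_same ss2 _ _ tab1.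
  - by rewrite (proj1 ss2).
  - by rewrite (proj2 ss2) // (proj2 ss1).
  - by [].
  - by move=> i iN; rewrite nth_mkseq.
have T0 v : arr s2 8 v = 0 by rewrite (proj2 ss2) // (proj2 ss1).
have cur0 v : arr s2 10 v = 0 by rewrite (proj2 ss2) // (proj2 ss1).
have H3 := ok_same (ok_optimize n0 szl uql ltl pf srch2 T0 cur0).
apply: ok_seq; apply: ok_weaken H3 (leqnn _) _ => s3 [ss3 opt3].
have srch3 : searched n K r (arr s2 6) (tab c) l s3.
  exact: searched_same ss3 _ _ srch2.
have H4 := ok_same (ok_trace n0 szl uql ltl pf srch3 opt3).
apply: ok_seq; apply: ok_weaken H4 (leqnn _) _ => s4 [ss4 tr].
have ready : output_ready n K (adj G) (arr s4 13) s4.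
  split=> //; first by apply: tables_same ss4 _ _ _ => //; case: srch3.
  by move=> u v un vn; rewrite (proj2 ss4) // (proj2 ss3) // (proj2 ss2) // adj1.
apply: ok_weaken (ok_output ready) (leqnn _) _ => s5 [_ _ w2 w3].
exists (fun k : 'I_K => level G (fun u => arr s4 13 u) k); split; last first.
  exact: traced_max_packing szl uql ltl pf edge_l tr.
move=> k u; have ltp : k * n + u < K * n.
  by apply: (@leq_trans (k.+1 * n)); [rewrite mulSnr ltn_add2l | rewrite leq_mul2r ltn_ord orbT].
have divE (q : nat) (w : 'I_n) : (q * n + w) %/ n = q.
  by rewrite divnMDl // divn_small // addn0.
have modE (q : nat) (w : 'I_n) : (q * n + w) %% n = w.
  by rewrite modnMDl modn_small.
split=> [|v].
  by rewrite w2 // /vertex_bit divE modE inE.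
rewrite w3; last first.
  apply: (@leq_trans ((k * n + u).+1 * n)); first by rewrite mulSnr ltn_add2l.
  by rewrite leq_mul2r ltp orbT.
by rewrite /edge_bit !divE !modE adj_ord.
Qed.

Theorem theorem3 :
  exists (p : cmd) (C : nat),
    forall (n K : nat) (G : sgraph 'I_n) (r : 'I_n) (c : 'I_n -> nat),
      0 < K ->
      verts G = [set: 'I_n] ->
      is_tree G ->
      exists t : nat,
        t <= C * (n ^ 3 * K ^ 3) /\ solves_mbrtp p G r c K t.
Proof.
exists program, 5000 => n K G r c K0 vertsG treeG.
have n0 : 0 < n := leq_ltn_trans (leq0n r) (ltn_ord r).
have [t [s [le_t ex [T [out maxT]]]]] := ok_program r c K vertsG treeG.
exists t; split; first exact: leq_trans le_t (program_time_le n0 K0).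
by exists s, T.
Qed.
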